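(* Let $0<a<b$ and $c_l>0$, and let $f=-e_2$. The optimal design is classical and ordered. More precisely, if $\theta\in L^\infty(I;[0,1])$ is a critical point of $\hat J$, then there exists $t^\ast\in(0,1)$ such that $A(\theta)=b$ almost everywhere on $(0,t^\ast)$ and $A(\theta)=a$ almost everywhere on $(t^\ast,1)$.
   Context: $I=(0,1)$. $X=\{K\in W^{1,2}(I): K(0)=0\}$ with dual $X'$, and $\tilde X=\{K\in X: K(t)\in(-\frac{\pi}{2},0]\text{ for all }t\in[0,1)\}$. Put $A(\theta)=\left(\frac{1-\theta}{a}+\frac{\theta}{b}\right)^{-1}$ (applied pointwise to functions); thus $A(0)=a$ (soft material), $A(1)=b$ (hard material). For $\theta\in L^\infty(I)$ with values in $[0,1]$ (more generally, in $(-\varepsilon,1+\varepsilon)$ with $\varepsilon>0$ small depending on $a,b$), $K(\theta)$ denotes the unique $K\in\tilde X$ solving the state equation $(A(\theta)K')'=(1-t)\cos K$ in $X'$, i.e. $-\int_0^1 A(\theta)K'\varphi'\,dt=\int_0^1(1-t)\cos(K)\,\varphi\,dt$ for all $\varphi\in X$. ($K(\theta)$ is the phase of the clamped planar beam with stiffness $A(\theta)$ minimizing the energy $\frac12\int_0^1 A(\theta)(K')^2\,dt+\int_0^1(1-t)\sin K\,dt$ over $X$ under the force $f=-e_2$.) The compliance is $\hat J(\theta)=-\int_0^1(1-t)\sin(K(\theta)(t))\,dt+c_l\int_0^1\theta(t)\,dt$, and an optimal design is a minimizer of $\hat J$ over $L^\infty(I;[0,1])$. It is called classical if it involves no microstructure,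 i.e. $\theta\in\{0,1\}$ almost everywhere. The map $\hat J$ is Fréchet differentiable with respect to the $L^\infty$ norm, with derivative $D\hat J(\theta)$. A function $\theta\in L^\infty(I;[0,1])$ is called a critical point of $\hat J$ if it satisfies the equilibrium condition for minimizers: $D\hat J(\theta)(\eta)\ge 0$ for all $\eta\in L^\infty(I)$ satisfying $\eta\ge0$ almost everywhere on $\{\theta=0\}$ and $\eta\le 0$ almost everywhere on $\{\theta=1\}$.
   Formalization: The switching point t* ranges over [0,1) instead of (0,1): for c_l ≥ (1/a − 1/b)/4 the all-soft design θ = 0 is a critical point with A(θ) = a a.e., so no t* > 0 exists; whenever θ is not a.e. 0, t* lies in (0,1). *)

(* Defs.v *)
From HB Require Import structures.
From mathcomp Require Import all_boot all_order all_algebra.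
From mathcomp Require Import all_classical all_reals all_analysis.
Set Implicit Arguments.
Unset Strict Implicit.
Unset Printing Implicit Defensive.
Import Order.TTheory GRing.Theory Num.Theory.
Import numFieldNormedType.Exports.
Local Open Scope classical_set_scope.
Local Open Scope ring_scope.

(* MathComp-Analysis. Functions on I = (0,1) are represented by total functions
   R -> R; their values outside [0,1] (outside I for classes of functions
   defined almost everywhere) play no role. *)

Definition unit_itv (R : realType) : set R := `]0, 1[%classic.

Definition memLp (R : realType) (p : \bar R) (f : R -> R) : Prop :=
  f \_ (@unit_itv R) \in Lfun (@lebesgue_measure R) p.

Definition Linfty_norm (R : realType) (f : R -> R) : R :=
  fine ('N[@lebesgue_measure R]_+oo[EFin \o (f \_ (@unit_itv R))]).

Definition ae_unit_itv (R : realType) (P : R -> Prop) : Prop :=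
  {ae @lebesgue_measure R, forall t, @unit_itv R t -> P t}.

Definition int01 (R : realType) (f : R -> R) : R :=
  \int[@lebesgue_measure R]_(t in @unit_itv R) f t.

(* C^1 functions with compact support in I; they define the same weak
   derivatives as the smooth ones. *)
Definition test_function (R : realType) (phi : R -> R) : Prop :=
  [/\ forall x : R, derivable phi x 1,
      continuous (derive1 phi),
      compact (closure [set x | phi x != 0])
    & closure [set x | phi x != 0] `<=` @unit_itv R].

Definition is_weak_derivative (R : realType) (K G : R -> R) : Prop :=
  memLp 2%:E G /\
  forall phi, test_function phi ->
    int01 (fun t => K t * derive1 phi t) = - int01 (fun t => G t * phi t).

(* Some weak derivative of K in L^2(I), which is unique almost everywhere. *)
Definition weak_deriv (R : realType) (K : R -> R) : R -> R :=
  xget (fun=> 0) [set G | is_weak_derivative K G].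

(* W^{1,2}(I), each class being represented by its element that is continuous
   on [0,1], so that pointwise conditions make sense. *)
Definition sobolev12 (R : realType) (K : R -> R) : Prop :=
  [/\ {within `[0, 1], continuous K},
      memLp 2%:E K
    & exists G, is_weak_derivative K G].

Definition spaceX (R : realType) (K : R -> R) : Prop :=
  sobolev12 K /\ K 0 = 0.

Definition spaceXtilde (R : realType) (K : R -> R) : Prop :=
  spaceX K /\ forall t : R, 0 <= t < 1 -> - (pi / 2) < K t <= 0.

Definition stiffness (R : realType) (a b theta : R) : R :=
  ((1 - theta) / a + theta / b)^-1.

Definition state_equation (R : realType) (a b : R) (theta K : R -> R) : Prop :=
  forall phi, spaceX phi ->
    - int01 (fun t => stiffness a b (theta t) * weak_deriv K t
                        * weak_deriv phi t)
    = int01 (fun t => (1 - t) * cos (K t) * phi t).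

(* K(theta); two solutions in spaceXtilde agree on [0,1]. *)
Definition phase (R : realType) (a b : R) (theta : R -> R) : R -> R :=
  xget (fun=> 0) [set K | spaceXtilde K /\ state_equation a b theta K].

Definition compliance (R : realType) (a b c_l : R) (theta : R -> R) : R :=
  - int01 (fun t => (1 - t) * sin (phase a b theta t))
  + c_l * int01 theta.

(* L^oo(I;[0,1]) *)
Definition design (R : realType) (theta : R -> R) : Prop :=
  memLp +oo%E theta /\ ae_unit_itv (fun t => 0 <= theta t <= 1).

Definition optimal_design (R : realType) (a b c_l : R) (theta : R -> R) : Prop :=
  design theta /\
  forall psi, design psi ->
    compliance a b c_l theta <= compliance a b c_l psi.

Definition classical_design (R : realType) (theta : R -> R) : Prop :=
  ae_unit_itv (fun t => theta t = 0 \/ theta t = 1).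

(* L is the Frechet derivative of J at theta for the L^oo(I) norm. Boundedness
   makes L compatible with almost everywhere equality. *)
Definition is_frechet_derivative (R : realType)
    (J : (R -> R) -> R) (theta : R -> R) (L : (R -> R) -> R) : Prop :=
  [/\ forall c eta1 eta2, memLp +oo%E eta1 -> memLp +oo%E eta2 ->
        L (fun t => c * eta1 t + eta2 t) = c * L eta1 + L eta2,
      exists C, forall eta, memLp +oo%E eta ->
        `|L eta| <= C * Linfty_norm eta
    & forall e, 0 < e -> exists2 d, 0 < d &
        forall eta, memLp +oo%E eta -> Linfty_norm eta <= d ->
          `|J (fun t => theta t + eta t) - J theta - L eta|
            <= e * Linfty_norm eta].

Definition critical_point (R : realType) (a b c_l : R) (theta : R -> R) : Prop :=
  design theta /\
  exists2 L, is_frechet_derivative (compliance a b c_l) theta L &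
    forall eta, memLp +oo%E eta ->
      ae_unit_itv (fun t => theta t = 0 -> 0 <= eta t) ->
      ae_unit_itv (fun t => theta t = 1 -> eta t <= 0) ->
      0 <= L eta.

(* Hard on (0,tstar), soft on (tstar,1). The case tstar = 0 does occur: if
   c_l >= (1/a - 1/b) / 4 then theta = 0 is a critical point and a minimizer. *)
Definition switches_at (R : realType) (a b : R) (theta : R -> R) (tstar : R)
    : Prop :=
  {ae @lebesgue_measure R, forall t : R, 0 < t < tstar ->
     stiffness a b (theta t) = b} /\
  {ae @lebesgue_measure R, forall t : R, tstar < t < 1 ->
     stiffness a b (theta t) = a}.

(* Main.v *)
Require Import Defs.
From mathcomp Require Import all_boot all_order all_algebra.
From mathcomp Require Import all_classical all_reals all_analysis.
From mathcomp Require Import measurable_realfun ess_sup_inf.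
From mathcomp Require Import ring lra.

(* Write k = - K, beta = 1 / A(theta) (which is affine in theta), and let
   M(t) = int_t^1 (1-s) cos k(s) ds.  The state equation integrates to k' = beta M,
   k(0) = 0, that is k = G((1-t) cos k) with the positive Green operator
   G r = int_0^. beta(s) int_s^1 r.  Equations k = G(F(., k)) with F antitone and
   1-Lipschitz are solved by a damped iteration that contracts the quadratic form
   int r G r.  In the same way one gets the adjoint state
   p = G((1-t)(cos k - p sin k)); with q = p' / beta the derivative of the
   compliance in direction eta is
     int (c_l - (1/a - 1/b) M q) eta.
   Testing with eta = - theta where the bracket is positive and eta = 1 - theta
   where it is negative, theta = 0 where M q is below a positive level and
   theta = 1 where M q is above it.  Finally p >= 0 by a comparison argument, so
   cos k - p sin k decreases wherever p does not decrease; hence {q > 0} is an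
   initial interval on which q is nonincreasing, and there M q is strictly
   decreasing and crosses the level at most once. *)

Set Implicit Arguments.
Unset Strict Implicit.
Unset Printing Implicit Defensive.
Import Order.TTheory GRing.Theory Num.Theory.
Import numFieldNormedType.Exports.
Local Open Scope classical_set_scope.
Local Open Scope ring_scope.

(** * Integrals and primitives on the unit interval *)

(** The obstacle is that no constant is small: [1 / a] is arbitrary, so neither Picard iteration for
    [k = G(F(., k))] nor a naive perturbation estimate closes. Signs replace smallness. On the range
    [[0, pi / 2]] the cosine is antitone and the sine nonnegative, so the state and the adjoint
    equation are both monotone, and energy estimates give existence as well as Lipschitz dependence
    of the state on the design. The state is never differentiated with respect to the design:
    pairing the exact difference of two states with the adjoint leaves the derivative of the
    compliance plus a remainder quadratic in the step. Minimizers and critical points are treated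
    together, through a one-sided inequality along segments of designs. Since [k], [p] and [q] are
    only primitives of bounded functions, all monotonicity is read off from integrals over
    subintervals. The strict bound [k < pi / 2] on [[0, 1)] makes [M] strictly decreasing, so that
    [M q] cannot stay at the positive level on a set of positive measure; this is what excludes
    microstructure. *)

Section integration.
Context {R : realType}.
Notation mu := (@lebesgue_measure R).
Notation I := (@unit_itv R).
Implicit Types (u v w : R -> R) (s t : R).

Definition itg u := mu.-integrable I (EFin \o u).
(** This class, unlike [itg], is closed under products, and [prim] and [tail] map integrable
    functions into it; most integrability side conditions are settled by it. *)
Definition bm u := measurable_fun I u /\ exists C, forall t, I t -> `|u t| <= C.
Definition step s t : R := (s <= t)%R%:R.
(* The indicator puts both primitives over the fixed domain I, where Fubini's
   theorem becomes the adjunction [exchange]. *)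
Definition prim v t := int01 (fun s => v s * step s t).
Definition tail u s := int01 (fun t => u t * step s t).

Lemma norm_step s t : `|step s t| <= 1.
Proof. by rewrite /step; case: (s <= t)%R; rewrite ?normr1 ?normr0. Qed.

Lemma unit_itvE t : I t = (0 < t < 1) :> Prop.
Proof. by rewrite /unit_itv /= in_itv. Qed.

Lemma measurable_I : measurable (I : set (measurableTypeR R)).
Proof. exact: measurable_itv. Qed.
Hint Resolve measurable_I : core.

Lemma mu_I : mu I = 1%E.
Proof. by rewrite lebesgue_measure_itv/= lte_fin ltr01 oppr0 adde0. Qed.

Lemma bm_itg u : bm u -> itg u.
Proof.
move=> [mu1 [C hC]]; apply: measurable_bounded_integrable => //.
  by rewrite /= mu_I ltry.
exists C; split; first exact: num_real.
by move=> x Cx t It; apply: (le_trans (hC t It)); exact: ltW.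
Qed.

Lemma itg_measurable u : itg u -> measurable_fun I u.
Proof. by move=> /integrableP[/measurable_EFinP]. Qed.

Lemma bmD u v : bm u -> bm v -> bm (fun t => u t + v t).
Proof.
move=> [mu1 [C hC]] [mv [D hD]]; split; first exact: measurable_funD.
by exists (C + D) => t It; rewrite (le_trans (ler_normD _ _))// lerD ?hC ?hD.
Qed.

Lemma bmN u : bm u -> bm (fun t => - u t).
Proof.
move=> [mu1 [C hC]]; split; first exact: measurableT_comp.
by exists C => t It; rewrite normrN hC.
Qed.

Lemma bmB u v : bm u -> bm v -> bm (fun t => u t - v t).
Proof. by move=> hu hv; apply: bmD => //; exact: bmN. Qed.

Lemma bmM u v : bm u -> bm v -> bm (fun t => u t * v t).
Proof.
move=> [mu1 [C hC]] [mv [D hD]]; split; first exact: measurable_funM.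
by exists (C * D) => t It; rewrite normrM ler_pM ?hC ?hD.
Qed.

Lemma bm_cst c : bm (fun=> c).
Proof. by split; [exact: measurable_cst | exists `|c|]. Qed.

Lemma bmZ c u : bm u -> bm (fun t => c * u t).
Proof. by move=> hu; apply: bmM => //; exact: bm_cst. Qed.

Lemma bm_id : bm id.
Proof.
split; first exact: measurable_id.
exists 1 => t; rewrite unit_itvE => /andP[t0 t1].
by rewrite ger0_norm ltW.
Qed.

Lemma bm_stepl s : bm (step s).
Proof.
split; last by exists 1 => t _; exact: norm_step.
rewrite /step; under eq_fun do rewrite mulrb.
apply: measurable_funTS; apply: measurable_fun_ifT => //=.
by apply: measurable_fun_ler.
Qed.

Lemma bm_stepr t : bm (step^~ t).
Proof.
split; last by exists 1 => s _; exact: norm_step.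
rewrite /step; under eq_fun do rewrite mulrb.
apply: measurable_funTS; apply: measurable_fun_ifT => //=.
by apply: measurable_fun_ler.
Qed.

Lemma itgD u v : itg u -> itg v -> itg (fun t => u t + v t).
Proof. by move=> iu iv; have := integrableD measurable_I iu iv. Qed.

Lemma itgB u v : itg u -> itg v -> itg (fun t => u t - v t).
Proof. by move=> iu iv; have := integrableB measurable_I iu iv. Qed.

Lemma itgM u v : itg u -> bm v -> itg (fun t => u t * v t).
Proof.
move=> iu [mv [C hC]].
have := @integrableMl _ _ _ mu I measurable_I (EFin \o u) v iu mv.
apply; exists C; split; first exact: num_real.
by move=> x Cx t It; apply: (le_trans (hC t It)); exact: ltW.
Qed.

Lemma itgZ c u : itg u -> itg (fun t => c * u t).
Proof.
move=> iu; have := itgM iu (bm_cst c); congr itg.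
by apply/funext => t; rewrite mulrC.
Qed.

Lemma int01D u v : itg u -> itg v -> int01 (fun t => u t + v t) = int01 u + int01 v.
Proof. exact: RintegralD. Qed.

Lemma int01B u v : itg u -> itg v -> int01 (fun t => u t - v t) = int01 u - int01 v.
Proof. exact: RintegralB. Qed.

Lemma int01Z c u : itg u -> int01 (fun t => c * u t) = c * int01 u.
Proof. exact: RintegralZl. Qed.

Lemma int01N u : itg u -> int01 (fun t => - u t) = - int01 u.
Proof.
move=> iu; rewrite -mulN1r -int01Z//.
by congr int01; apply/funext => t; rewrite mulN1r.
Qed.

Lemma int01_cst c : int01 (fun=> c : R) = c.
Proof. by rewrite /int01 Rintegral_cst//= mu_I mulr1. Qed.

Lemma eq_int01 u v : (forall t, 0 < t < 1 -> u t = v t) -> int01 u = int01 v.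
Proof.
by move=> uv; apply: eq_Rintegral => t; rewrite inE /unit_itv/= in_itv; exact: uv.
Qed.

Lemma ae_eq_int01 u v : measurable_fun I u -> measurable_fun I v ->
  ae_unit_itv (fun t => u t = v t) -> int01 u = int01 v.
Proof.
move=> mu1 mv uv; congr fine; apply: ae_eq_integral => //.
- exact/measurable_EFinP.
- exact/measurable_EFinP.
- by apply: (@filterS _ _ (ae_filter_ringOfSetsType mu) _ _ _ uv) => t h It /=; rewrite h.
Qed.

Lemma le_int01 u v : itg u -> itg v -> (forall t, 0 < t < 1 -> u t <= v t) ->
  int01 u <= int01 v.
Proof.
by move=> iu iv uv; apply: le_Rintegral => // t; rewrite unit_itvE; exact: uv.
Qed.

Lemma int01_ge0 u : (forall t, 0 < t < 1 -> 0 <= u t) -> 0 <= int01 u.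
Proof. by move=> u0; apply: Rintegral_ge0 => t; rewrite unit_itvE; exact: u0. Qed.

Lemma itg_norm u : itg u -> itg (fun t => `|u t|).
Proof. by move=> iu; exact: integrable_norm. Qed.

Lemma norm_int01_le u v : itg u -> itg v ->
  (forall t, 0 < t < 1 -> `|u t| <= v t) -> `|int01 u| <= int01 v.
Proof.
move=> iu iv uv; apply: (le_trans (le_normr_Rintegral _ iu)) => //.
exact: (le_int01 (itg_norm iu)).
Qed.

Lemma norm_int01 u C : itg u ->
  (forall t, 0 < t < 1 -> `|u t| <= C) -> `|int01 u| <= C.
Proof.
move=> iu uC; rewrite -(int01_cst C); apply: norm_int01_le => //.
by apply: bm_itg; exact: bm_cst.
Qed.

Lemma itg_prim v t : itg v -> itg (fun s => v s * step s t).
Proof. by move=> iv; apply: itgM => //; exact: bm_stepr. Qed.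

Lemma itg_tail u s : itg u -> itg (fun t => u t * step s t).
Proof. by move=> iv; apply: itgM => //; exact: bm_stepl. Qed.

(** Integration by parts in integral form; no boundary terms occur because [prim v] vanishes at 0
    and [tail u] at 1. The symmetry of the Green operator, the passage between weak and integral
    equations and the adjoint computation all rest on it. *)
Lemma exchange u v : itg u -> itg v ->
  int01 (fun t => u t * prim v t) = int01 (fun s => v s * tail u s).
Proof.
move=> iu iv.
pose U := u \_ I; pose V := v \_ I.
have mU : measurable_fun setT U.
  by apply/(measurable_restrictT _ measurable_I); exact: itg_measurable.
have mV : measurable_fun setT V.
  by apply/(measurable_restrictT _ measurable_I); exact: itg_measurable.
pose h (z : R * R) : R := U z.1 * (V z.2 * step z.2 z.1).
have mh : measurable_fun setT h.
  apply: measurable_funM; first exact: measurableT_comp.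
  apply: measurable_funM; first exact: measurableT_comp.
  rewrite /step; under eq_fun do rewrite mulrb.
  apply: measurable_fun_ifT => //=.
  by apply: measurable_fun_ler.
have e1 x : (\int[mu]_y (EFin \o h) (x, y) = (U x * prim v x)%:E)%E.
  have -> : (\int[mu]_y (EFin \o h) (x, y) =
     \int[mu]_(y in I) ((U x)%:E * (v y * step y x)%:E))%E.
    rewrite [RHS]integral_mkcond; apply: eq_integral => y _ /=.
    rewrite patchE /h /= /V patchE; case: ifP => _; first by rewrite EFinM.
    by rewrite mul0r mulr0.
  rewrite integralZl//; last exact: itg_prim.
  rewrite EFinM; congr (_ * _)%E; rewrite /prim /int01 /Rintegral fineK//.
  by apply: integrable_fin_num => //; exact: itg_prim.
have e2 y : (\int[mu]_x (EFin \o h) (x, y) = (V y * tail u y)%:E)%E.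
  have -> : (\int[mu]_x (EFin \o h) (x, y) =
     \int[mu]_(x in I) ((V y)%:E * (u x * step y x)%:E))%E.
    rewrite [RHS]integral_mkcond; apply: eq_integral => x _ /=.
    rewrite patchE /h /= /U patchE; case: ifP => _; last by rewrite mul0r.
    by rewrite -EFinM mulrCA.
  rewrite integralZl//; last exact: itg_tail.
  rewrite EFinM; congr (_ * _)%E; rewrite /tail /int01 /Rintegral fineK//.
  by apply: integrable_fin_num => //; exact: itg_tail.
have eL : int01 (fun t => u t * prim v t) = \int[mu]_x (U x * prim v x).
  rewrite /int01 Rintegral_mkcond; congr fine; apply: eq_integral => x _.
  by rewrite /U !patchE; case: ifP => //; rewrite mul0r.
have eR : int01 (fun s => v s * tail u s) = \int[mu]_x (V x * tail u x).
  rewrite /int01 Rintegral_mkcond; congr fine; apply: eq_integral => x _.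
  by rewrite /V !patchE; case: ifP => //; rewrite mul0r.
rewrite {}eL {}eR; congr fine; under eq_integral do rewrite -e1.
under [RHS]eq_integral do rewrite -e2.
apply: Fubini.
apply/integrable12ltyP; first exact/measurable_EFinP.
have iV : (\int[mu]_y `|V y|%:E < +oo)%E.
  have /integrableP[_] : mu.-integrable setT (EFin \o V).
    by rewrite -restrict_EFin; apply/integrable_restrict => //; rewrite setTI.
  by [].
have iU : (\int[mu]_y `|U y|%:E < +oo)%E.
  have /integrableP[_] : mu.-integrable setT (EFin \o U).
    by rewrite -restrict_EFin; apply/integrable_restrict => //; rewrite setTI.
  by [].
(* The step function is at most 1, so the kernel is dominated by the integrable product of [U] and
   [V]. *)
apply: (@le_lt_trans _ _ (\int[mu]_x (`|U x|%:E * \int[mu]_y `|V y|%:E))%E).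
  apply: ge0_le_integral => //.
  - by move=> x _; apply: integral_ge0.
  - apply: (@measurable_fun_fubini_tonelli_F _ _ _ _ _ mu (fun z => (`|h z|)%:E)) => //.
    by apply/measurable_EFinP; exact: measurableT_comp.
  - apply: emeasurable_funM; last exact: measurable_cst.
    by apply/measurable_EFinP; exact: measurableT_comp.
  - move=> x _; rewrite -ge0_integralZl//; last first.
      by apply/measurable_EFinP; exact: measurableT_comp.
    apply: ge0_le_integral => //.
    + apply/measurable_EFinP; apply: measurableT_comp => //.
      exact: (measurableT_comp mh (pair1_measurable x)).
    + apply/measurable_EFinP; apply: measurable_funM => //; exact: measurableT_comp.
    + move=> y _; rewrite /= /h /= lee_fin normrM ler_wpM2l// normrM.
      by rewrite ler_piMr// norm_step.
rewrite ge0_integralZr//; last 2 first.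
  by apply/measurable_EFinP; exact: measurableT_comp.
  by apply: integral_ge0.
by apply: lte_mul_pinfty => //; [exact: integral_ge0 | rewrite ge0_fin_numE// integral_ge0].
Qed.

End integration.

(** * Primitives and tails as functions of their endpoint *)

Section primitives.
Context {R : realType}.
Notation mu := (@lebesgue_measure R).
Notation I := (@unit_itv R).
Implicit Types (u v w : R -> R) (s t : R).
Hint Resolve measurable_I : core.

Lemma ae_unit_itv_filter (P Q : R -> Prop) :
  (forall t, 0 < t < 1 -> P t -> Q t) -> ae_unit_itv P -> ae_unit_itv Q.
Proof.
move=> PQ; apply: (@filterS _ _ (ae_filter_ringOfSetsType mu)) => t h It.
by apply: PQ; [rewrite -unit_itvE | exact: h].
Qed.

Lemma ae_unit_itvI (P Q : R -> Prop) :
  ae_unit_itv P -> ae_unit_itv Q -> ae_unit_itv (fun t => P t /\ Q t).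
Proof.
apply: (@filterS2 _ _ (ae_filter_ringOfSetsType mu)) => t hp hq It.
by split; [exact: hp | exact: hq].
Qed.

Lemma ae_unit_itv_neq s : ae_unit_itv (fun t => t != s).
Proof.
exists [set s]; split => //; first exact: lebesgue_measure_set1.
move=> t /= /not_implyP[_ /negP]; rewrite negbK => /eqP ->//.
Qed.

(** At [t = s] both indicators equal 1, so the integrands agree only off that null set. *)
Lemma tail_prim u s : itg u -> tail u s = int01 u - prim u s.
Proof.
move=> iu; apply/eqP; rewrite eq_sym subr_eq -int01D; last 2 first.
- exact: itg_tail.
- exact: itg_prim.
apply/eqP; apply: ae_eq_int01.
- exact: itg_measurable.
- by apply: itg_measurable; apply: itgD; [exact: itg_tail | exact: itg_prim].
- apply: ae_unit_itv_filter (ae_unit_itv_neq s) => t _ ts.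
  rewrite -mulrDr /step; have [st|st] := ltP s t.
    by rewrite (ltW st) addr0 mulr1.
  by rewrite leNgt lt_neqAle ts st/= add0r mulr1.
Qed.

Lemma prim_Rintegral v t : prim v t = \int[mu]_(x in `[0, t]) (v \_ I) x.
Proof.
rewrite /prim /int01 Rintegral_mkcond [RHS]Rintegral_mkcond.
congr Rintegral; apply/funext => x; rewrite !patchE.
have [xI|xI] := boolP (x \in I); last by case: ifP.
move: xI; rewrite inE unit_itvE => /andP[x0 x1].
rewrite /step; have [xt|xt] := leP x t.
  by rewrite mulr1 mem_set//= in_itv/= xt ltW.
by rewrite mulr0 memNset//= in_itv/= [x <= t]leNgt xt andbF.
Qed.

Lemma integrable_restrict_I v (A : set (measurableTypeR R)) : measurable A -> itg v ->
  mu.-integrable A (EFin \o (v \_ I)).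
Proof.
move=> mA iv; apply: (@integrableS _ _ _ mu setT) => //.
by rewrite -restrict_EFin; apply/integrable_restrict => //; rewrite setTI.
Qed.

Lemma prim_continuous v : itg v -> {within `[0, 1], continuous (prim v)}.
Proof.
move=> iv; have -> : prim v = fun t => \int[mu]_(x in `[0, t]) (v \_ I) x.
  by apply/funext => t; rewrite prim_Rintegral.
by apply: parameterized_integral_continuous => //; exact: integrable_restrict_I.
Qed.

Lemma prim_bm v : itg v -> bm (prim v).
Proof.
move=> iv; split.
  apply: subspace_continuous_measurable_fun; first exact: measurable_itv.
  apply: (continuous_subspaceW _ (prim_continuous iv)).
  exact: subset_itv_oo_cc.
exists (int01 (fun t => `|v t|)) => t _; apply: norm_int01_le.
- exact: itg_prim.
- exact: itg_norm.
- by move=> x _; rewrite normrM ler_piMr// norm_step.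
Qed.

Lemma tail_bm u : itg u -> bm (tail u).
Proof.
move=> iu; have -> : tail u = fun s => int01 u - prim u s.
  by apply/funext => s; rewrite tail_prim.
by apply: bmB; [exact: bm_cst | exact: prim_bm].
Qed.

Lemma prim0 v t : t <= 0 -> prim v t = 0.
Proof.
move=> t0; rewrite -(int01_cst 0); apply: eq_int01 => x /andP[x0 _].
by rewrite /step leNgt (le_lt_trans t0 x0) mulr0.
Qed.

Lemma prim1 v t : 1 <= t -> prim v t = int01 v.
Proof.
move=> t1; apply: eq_int01 => x /andP[_ x1].
by rewrite /step (le_trans (ltW x1) t1) mulr1.
Qed.

Lemma tail1 u : tail u 1 = 0.
Proof.
rewrite -(int01_cst 0); apply: eq_int01 => x /andP[_ x1].
by rewrite /step leNgt x1 mulr0.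
Qed.

Lemma eq_prim u v : (forall t, 0 < t < 1 -> u t = v t) -> prim u = prim v.
Proof. by move=> uv; apply/funext => t; apply: eq_int01 => x xI; rewrite uv. Qed.

Lemma eq_tail u v : (forall t, 0 < t < 1 -> u t = v t) -> tail u = tail v.
Proof. by move=> uv; apply/funext => t; apply: eq_int01 => x xI; rewrite uv. Qed.

Lemma primD u v t : itg u -> itg v ->
  prim (fun x => u x + v x) t = prim u t + prim v t.
Proof.
move=> iu iv; rewrite -int01D; [|exact: itg_prim..].
by apply: eq_int01 => x _; rewrite mulrDl.
Qed.

Lemma primZ c u t : itg u -> prim (fun x => c * u x) t = c * prim u t.
Proof.
move=> iu; rewrite -int01Z; last exact: itg_prim.
by apply: eq_int01 => x _; rewrite mulrA.
Qed.

Lemma primB u v t : itg u -> itg v ->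
  prim (fun x => u x - v x) t = prim u t - prim v t.
Proof.
move=> iu iv; rewrite -int01B; [|exact: itg_prim..].
by apply: eq_int01 => x _; rewrite mulrBl.
Qed.

Lemma tailB u v t : itg u -> itg v ->
  tail (fun x => u x - v x) t = tail u t - tail v t.
Proof.
move=> iu iv; rewrite -int01B; [|exact: itg_tail..].
by apply: eq_int01 => x _; rewrite mulrBl.
Qed.

Lemma tailD u v t : itg u -> itg v ->
  tail (fun x => u x + v x) t = tail u t + tail v t.
Proof.
move=> iu iv; rewrite -int01D; [|exact: itg_tail..].
by apply: eq_int01 => x _; rewrite mulrDl.
Qed.

Lemma tailZ c u t : itg u -> tail (fun x => c * u x) t = c * tail u t.
Proof.
move=> iu; rewrite -int01Z; last exact: itg_tail.
by apply: eq_int01 => x _; rewrite mulrA.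
Qed.

Lemma itg_cst c : itg (fun _ : R => c).
Proof. by apply: bm_itg; exact: bm_cst. Qed.

Lemma prim_Rintegral_itv v t : itg v -> measurable_fun `[0, t] v -> t <= 1 ->
  prim v t = \int[mu]_(x in `[0, t]) v x.
Proof.
move=> iv mv t1; rewrite prim_Rintegral; congr fine; apply: ae_eq_integral => //.
- apply/measurable_EFinP; apply: measurable_funTS.
  by apply/(measurable_restrictT _ measurable_I); exact: itg_measurable.
- exact/measurable_EFinP.
- have h (a : R) : {ae mu, forall x, x != a}.
    exists [set a]; split => //; first exact: lebesgue_measure_set1.
    by move=> x /= /negP; rewrite negbK => /eqP.
  apply: (@filterS2 _ _ (ae_filter_ringOfSetsType mu) _ _ _ _ (h 0) (h 1)).
  move=> x x0 x1 /=; rewrite in_itv/= => /andP[x0' xt].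
  rewrite patchE mem_set// unit_itvE !lt_neqAle eq_sym x0 x0' x1/=.
  exact: le_trans xt t1.
Qed.

Lemma prim_cst c t : 0 <= t <= 1 -> prim (fun=> c) t = c * t.
Proof.
move=> /andP[t0 t1]; rewrite prim_Rintegral_itv//; [|exact: itg_cst].
rewrite Rintegral_cst//= lebesgue_measure_itv/= lte_fin.
by case: ltgtP t0 => // [t0 _|<-]; rewrite ?oppr0 ?adde0// !mulr0.
Qed.

Lemma prim_le v s t : itg v -> s <= t ->
  (forall x, 0 < x < 1 -> s < x <= t -> 0 <= v x) -> prim v s <= prim v t.
Proof.
move=> iv st v0; apply: le_int01; [exact: itg_prim..|].
move=> x xI; rewrite /step; have [xs|xs] := leP x s.
  by rewrite (le_trans xs st).
rewrite mulr0; have [xt|xt] := leP x t; last by rewrite mulr0.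
by rewrite mulr1 v0// xs.
Qed.

(** Plays the role of the mean value inequality for primitives that need not be differentiable
    everywhere; it follows from [prim_le] applied to [v - m]. The sign and growth arguments for [k],
    [p] and the moments go through this family of lemmas. *)
Lemma prim_incr_ge v m s t : itg v -> 0 <= s <= t -> t <= 1 ->
  (forall x, 0 < x < 1 -> s < x <= t -> m <= v x) ->
  m * (t - s) <= prim v t - prim v s.
Proof.
move=> iv /andP[s0 st] t1 vm.
have := @prim_le (fun x => v x - m) s t (itgB iv (itg_cst m)) st.
have pB x : 0 <= x <= 1 -> prim (fun y => v y - m) x = prim v x - m * x.
  by move=> x01; rewrite primB ?prim_cst//; exact: itg_cst.
rewrite !pB; [|by rewrite t1 (le_trans s0)|by rewrite s0 (le_trans st)].
have -> : (m * (t - s) <= prim v t - prim v s) =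
  (prim v s - m * s <= prim v t - m * t).
  by rewrite mulrBr; apply/idP/idP => h; lra.
by apply => x xI xst; rewrite subr_ge0 vm.
Qed.

Lemma prim_incr_le v m s t : itg v -> 0 <= s <= t -> t <= 1 ->
  (forall x, 0 < x < 1 -> s < x <= t -> v x <= m) ->
  prim v t - prim v s <= m * (t - s).
Proof.
move=> iv st t1 vm.
have := @prim_incr_ge (fun x => - 1 * v x) (- m) s t.
rewrite !primZ//; have iv' : itg (fun x => - 1 * v x).
  have := itgB (itg_cst 0) iv; congr itg; apply/funext => x.
  by rewrite sub0r mulN1r.
move=> /(_ iv' st t1) h; have : - m * (t - s) <= - 1 * prim v t - - 1 * prim v s.
  by apply: h => x xI xst; rewrite mulN1r lerN2 vm.
by lra.
Qed.

Lemma tail_decr_ge u m s t : itg u -> 0 <= s <= t -> t <= 1 ->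
  (forall x, 0 < x < 1 -> s < x <= t -> m <= u x) ->
  m * (t - s) <= tail u s - tail u t.
Proof.
move=> iu st t1 um; rewrite !tail_prim//.
by have := prim_incr_ge iu st t1 um; lra.
Qed.

Lemma tail_decr_le u m s t : itg u -> 0 <= s <= t -> t <= 1 ->
  (forall x, 0 < x < 1 -> s < x <= t -> u x <= m) ->
  tail u s - tail u t <= m * (t - s).
Proof.
move=> iu st t1 um; rewrite !tail_prim//.
by have := prim_incr_le iu st t1 um; lra.
Qed.

Lemma norm_prim v C t : itg v -> (forall x, 0 < x < 1 -> `|v x| <= C) ->
  `|prim v t| <= C.
Proof.
move=> iv vC; apply: norm_int01; first exact: itg_prim.
move=> x xI; rewrite normrM (le_trans _ (vC _ xI))//.
by rewrite ler_piMr// norm_step.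
Qed.

Lemma norm_tail u C s : itg u -> (forall x, 0 < x < 1 -> `|u x| <= C) ->
  `|tail u s| <= C.
Proof.
move=> iu uC; apply: norm_int01; first exact: itg_tail.
move=> x xI; rewrite normrM (le_trans _ (uC _ xI))//.
by rewrite ler_piMr// norm_step.
Qed.

(** By Lebesgue differentiation [v] is almost everywhere the derivative of its primitive, which
    vanishes near each point of the open interval. *)
Lemma prim_eq0 v : itg v -> (forall t, 0 <= t <= 1 -> prim v t = 0) ->
  ae_unit_itv (fun t => v t = 0).
Proof.
move=> iv v0.
have iT : mu.-integrable setT (EFin \o (v \_ I)) by exact: integrable_restrict_I.
have iv' y : mu.-integrable [set` Interval (BLeft (0:R)) (BRight y)] (EFin \o (v \_ I)).
  exact: integrable_restrict_I.
have locv : locally_integrable [set: R] (v \_ I).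
  by apply: open_integrable_locally => //; exact: openT.
have := FTC1 iv' locv.
apply: (@filterS _ _ (ae_filter_ringOfSetsType mu)) => t + It.
have t01 : 0 < t < 1 by move: It; rewrite (@unit_itvE R).
move: (t01) => /andP[t0 t1].
rewrite lte_fin => /(_ t0) [_ dF].
suff : v t = (v \_ I) t /\ (v \_ I) t = 0 by move=> [-> ->].
split; first by rewrite patchE mem_set// unit_itvE.
rewrite -dF derive1E.
have -> : (fun x => \int[mu]_(t in `[0, x]) (v \_ I) t) = prim v.
  by apply/funext => x; rewrite prim_Rintegral.
rewrite -(derive_cst (0 : R) (t : R) 1).
apply: near_eq_derive.
have : \forall x \near (t : R), x \in `]0, 1[%R by apply: near_in_itvoo; rewrite in_itv.
apply: filterS => x; rewrite in_itv/= => /andP[x0 x1].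
by rewrite v0// !ltW.
Qed.

End primitives.

Section integral_int01.
Context {R : realType}.
Lemma integral_int01 (u : R -> R) : itg u ->
  (\int[@lebesgue_measure R]_(t in @unit_itv R) (u t)%:E = (int01 u)%:E)%E.
Proof.
move=> iu; rewrite /int01 /Rintegral fineK//.
exact: (integrable_fin_num (@measurable_I R)).
Qed.

(** Integrating from minus infinity rather than from 0 lets the fundamental theorem be used at every
    real point, as [prim_derivable] requires. *)
Lemma prim_RintegralNy (v : R -> R) t : prim v t =
  \int[@lebesgue_measure R]_(x in `]-oo, t]) (v \_ (@unit_itv R)) x.
Proof.
rewrite /prim /int01 Rintegral_mkcond [RHS]Rintegral_mkcond.
congr Rintegral; apply/funext => x; rewrite !patchE.
have [xI|xI] := boolP (x \in (@unit_itv R)); last by case: ifP.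
rewrite /step; have [xt|xt] := leP x t.
  by rewrite mulr1 mem_set//= in_itv/= xt.
by rewrite mulr0 memNset//= in_itv/= [x <= t]leNgt xt.
Qed.
End integral_int01.

(* Keeps conversion from unfolding integrals when it compares their integrands. *)
Opaque int01.

(** * Convergence at a geometric rate *)

Section geometric_sequences.
Context {R : realType}.

Lemma le_geometric_eq0 (x D g : R) : 0 <= x -> 0 <= g < 1 ->
  (forall n, x <= D * g ^+ n) -> x = 0.
Proof.
move=> x0 /andP[g0 g1] xD; apply/eqP; rewrite eq_le x0 andbT.
have hc : (fun n => D * g ^+ n) @ \oo --> 0.
  by apply: cvg_geometric; rewrite ger0_norm.
by rewrite -(cvg_lim _ hc)//; apply: limr_ge; [apply/cvg_ex; exists 0 | exact: nearW].
Qed.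

Lemma geometric_increments_cvg (u : nat -> R) (C g : R) : 0 <= g < 1 ->
  (forall n, `|u n.+1 - u n| <= C * g ^+ n) ->
  exists2 l, u @ \oo --> l & forall n, `|l - u n| <= C / (1 - g) * g ^+ n.
Proof.
move=> /andP[g0 g1] uC.
have g1' : 0 < 1 - g by rewrite subr_gt0.
have C0 : 0 <= C by have := uC 0; rewrite expr0 mulr1; exact: le_trans.
(* Keeping the exact difference of powers, not just [g ^+ m], is what lets the induction on [n]
   close. *)
have step m n : `|u (m + n)%N - u m| <= C / (1 - g) * (g ^+ m - g ^+ (m + n)).
  elim: n => [|n IH]; first by rewrite addn0 !subrr normr0 mulr0.
  rewrite addnS.
  have -> : u (m + n).+1 - u m = (u (m + n).+1 - u (m + n)%N) + (u (m + n)%N - u m).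
    by ring.
  apply: (le_trans (ler_normD _ _)).
  have -> : C / (1 - g) * (g ^+ m - g ^+ (m + n).+1) =
    C * g ^+ (m + n) + C / (1 - g) * (g ^+ m - g ^+ (m + n)).
    by rewrite exprS; field; rewrite gt_eqF.
  by rewrite lerD.
have bd m n : `|u (m + n)%N - u m| <= C / (1 - g) * g ^+ m.
  apply: (le_trans (step m n)); rewrite ler_wpM2l//.
    by rewrite divr_ge0// ltW.
  by rewrite gerBl exprn_ge0.
have cu : cvg (u @ \oo).
  have -> : u = fun n => u 0 + series (telescope u) n.
    by apply/funext => n; exact: eq_sum_telescope.
  apply: is_cvgD; first exact: is_cvg_cst.
  apply: normed_cvg; apply: (series_le_cvg _ _ (fun n => uC n)) => //.
  - by move=> n; rewrite mulr_ge0// exprn_ge0.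
  - by apply: (is_cvg_geometric_series (a := C)); rewrite ger0_norm.
exists (lim (u @ \oo)) => // m.
have cn : (fun n => `|u n - u m|) @ \oo --> `|lim (u @ \oo) - u m|.
  by apply: cvg_norm; apply: cvgB => //; exact: cvg_cst.
rewrite -(cvg_lim _ cn)//; apply: limr_le; first by apply/cvg_ex; eexists; exact: cn.
exists m => // n /= mn; rewrite -(subnKC mn); exact: bd.
Qed.

End geometric_sequences.

Lemma mulB_antitone_le0 (R : realDomainType) (f : R -> R) x y :
  (forall a b, a <= b -> f b <= f a) -> (f x - f y) * (x - y) <= 0.
Proof.
move=> anti; have [le|/ltW le] := leP x y.
  by apply: mulr_ge0_le0; rewrite ?subr_ge0 ?subr_le0// anti.
by apply: mulr_le0_ge0; rewrite ?subr_ge0 ?subr_le0// anti.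
Qed.

(** * Monotone integral equations *)

Section green.
Context {R : realType}.
Notation I := (@unit_itv R).
Implicit Types (beta r s : R -> R).

(** The solution [y] of [(y' / beta)' = - r] with [y 0 = 0] and vanishing moment [y' / beta] at 1,
    in integrated form. *)
Definition green beta r := prim (fun x => beta x * tail r x).
Definition quad beta r := int01 (fun t => r t * green beta r t).

Lemma bm_beta_tail beta r : bm beta -> bm r -> bm (fun x => beta x * tail r x).
Proof. by move=> hb hr; apply: bmM => //; apply: tail_bm; exact: bm_itg. Qed.

Lemma green_bm beta r : bm beta -> bm r -> bm (green beta r).
Proof. by move=> hb hr; apply: prim_bm; apply: bm_itg; exact: bm_beta_tail. Qed.

Lemma greenB beta r s t : bm beta -> bm r -> bm s ->
  green beta (fun x => r x - s x) t = green beta r t - green beta s t.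
Proof.
move=> hb hr hs; rewrite -primB; [|by apply: bm_itg; exact: bm_beta_tail..].
by apply: (congr1 (@^~ t)); apply: eq_prim => x _; rewrite tailB ?mulrBr//; exact: bm_itg.
Qed.

Lemma greenD beta r s t : bm beta -> bm r -> bm s ->
  green beta (fun x => r x + s x) t = green beta r t + green beta s t.
Proof.
move=> hb hr hs; rewrite -primD; [|by apply: bm_itg; exact: bm_beta_tail..].
by apply: (congr1 (@^~ t)); apply: eq_prim => x _; rewrite tailD ?mulrDr//; exact: bm_itg.
Qed.

Lemma greenZ beta c r t : bm beta -> bm r ->
  green beta (fun x => c * r x) t = c * green beta r t.
Proof.
move=> hb hr; rewrite -primZ; last by apply: bm_itg; exact: bm_beta_tail.
by apply: (congr1 (@^~ t)); apply: eq_prim => x _; rewrite tailZ; [rewrite mulrCA | exact: bm_itg].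
Qed.

Lemma eq_green beta r s : (forall x, 0 < x < 1 -> r x = s x) ->
  green beta r = green beta s.
Proof. by move=> rs; apply: eq_prim => x xI; rewrite (eq_tail rs). Qed.

Lemma int01_green beta r s : bm beta -> bm r -> bm s ->
  int01 (fun t => s t * green beta r t) =
  int01 (fun t => beta t * (tail r t * tail s t)).
Proof.
move=> hb hr hs; rewrite exchange; [|exact: bm_itg|].
  by apply: eq_int01 => t _; rewrite mulrA.
by apply: bm_itg; exact: bm_beta_tail.
Qed.

Lemma int01_greenC beta r s : bm beta -> bm r -> bm s ->
  int01 (fun t => s t * green beta r t) = int01 (fun t => r t * green beta s t).
Proof.
move=> hb hr hs; transitivity (int01 (fun t => beta t * (tail r t * tail s t))).
  exact: int01_green.
transitivity (int01 (fun t => beta t * (tail s t * tail r t))).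
  by apply: eq_int01 => t _; congr (_ * _); rewrite mulrC.
by apply/esym; exact: int01_green.
Qed.

Lemma quad_lin beta c1 c2 r s : bm beta -> bm r -> bm s ->
  quad beta (fun t => c1 * r t + c2 * s t) =
  c1 ^+ 2 * quad beta r + 2 * c2 * c1 * int01 (fun t => s t * green beta r t) +
  c2 ^+ 2 * quad beta s.
Proof.
move=> hb hr hs.
have hgr := green_bm hb hr; have hgs := green_bm hb hs.
have gE t : green beta (fun x => c1 * r x + c2 * s x) t =
    c1 * green beta r t + c2 * green beta s t.
  by rewrite greenD ?greenZ//; exact: bmZ.
have h1 : itg (fun t => r t * green beta r t) by apply: bm_itg; exact: bmM.
have h2 : itg (fun t => s t * green beta r t) by apply: bm_itg; exact: bmM.
have h3 : itg (fun t => r t * green beta s t) by apply: bm_itg; exact: bmM.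
have h4 : itg (fun t => s t * green beta s t) by apply: bm_itg; exact: bmM.
have sym := int01_greenC hb hr hs.
have -> : quad beta (fun t => c1 * r t + c2 * s t) = int01 (fun t =>
    (c1 * r t + c2 * s t) * (c1 * green beta r t + c2 * green beta s t)).
  by apply: eq_int01 => t _; rewrite gE.
rewrite /quad.
move: (green beta r) (green beta s) sym h1 h2 h3 h4 => u v sym h1 h2 h3 h4.
rewrite -(int01Z _ h1) -(int01Z _ h4).
have -> : 2 * c2 * c1 * int01 (fun t => s t * u t) =
    int01 (fun t => c1 * c2 * (s t * u t)) + int01 (fun t => c1 * c2 * (r t * v t)).
  by rewrite (int01Z _ h2) (int01Z _ h3) sym; ring.
have i2 := itgZ (c1 * c2) h2; have i3 := itgZ (c1 * c2) h3.
have i1 := itgZ (c1 ^+ 2) h1; have i4 := itgZ (c2 ^+ 2) h4.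
rewrite -(int01D i2 i3) -(int01D i1 (itgD i2 i3)) -(int01D (itgD i1 (itgD i2 i3)) i4).
by apply: eq_int01 => t _; ring.
Qed.

Section bounded_weight.
Variables (beta : R -> R) (b1 : R).
Hypotheses (hb : bm beta) (b1_gt0 : 0 < b1).
Hypothesis beta01 : forall t, 0 < t < 1 -> 0 <= beta t <= b1.

Lemma norm_green r C t : bm r -> (forall x, 0 < x < 1 -> `|r x| <= C) ->
  `|green beta r t| <= b1 * C.
Proof.
move=> hr rC; apply: norm_prim; first by apply: bm_itg; exact: bm_beta_tail.
move=> x xI; have /andP[b0 bb] := beta01 xI.
by rewrite normrM ger0_norm// ler_pM// norm_tail//; exact: bm_itg.
Qed.

Lemma quadE r : bm r -> quad beta r = int01 (fun t => beta t * tail r t ^+ 2).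
Proof. by move=> hr; rewrite /quad int01_green. Qed.

Lemma quad_ge0 r : bm r -> 0 <= quad beta r.
Proof.
move=> hr; rewrite quadE//; apply: int01_ge0 => t tI.
by have /andP[b0 _] := beta01 tI; rewrite mulr_ge0// sqr_ge0.
Qed.

Lemma quad_le r C : bm r -> (forall x, 0 < x < 1 -> `|r x| <= C) ->
  quad beta r <= b1 * C ^+ 2.
Proof.
move=> hr rC; rewrite quadE// -(int01_cst (b1 * C ^+ 2)).
have ht := tail_bm (bm_itg hr).
apply: le_int01; [|exact: itg_cst|].
  by apply: bm_itg; apply: bmM => //; exact: bmM.
move=> t tI; have /andP[b0 bb] := beta01 tI.
rewrite ler_pM// ?sqr_ge0// -real_normK ?num_real//.
by rewrite lerXn2r ?nnegrE// ?norm_tail// ?(le_trans _ (rC _ tI))//; exact: bm_itg.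
Qed.

(* Cauchy-Schwarz in L^2(beta dt), as [green beta r t] integrates
   [beta * tail r] over (0, t). *)
Lemma green_sqr_le r t : bm r -> green beta r t ^+ 2 <= b1 * quad beta r.
Proof.
move=> hr; pose y := green beta r t; pose c := y / b1.
have ht := tail_bm (bm_itg hr).
have hs := bm_stepr t.
have : 0 <= int01 (fun x => beta x * (tail r x - c * step x t) ^+ 2).
  apply: int01_ge0 => x xI; have /andP[b0 _] := beta01 xI.
  by rewrite mulr_ge0// sqr_ge0.
have stepsq x : step x t ^+ 2 = step x t :> R.
  by rewrite /step; case: (x <= t); rewrite ?expr1n ?expr0n.
have -> : int01 (fun x => beta x * (tail r x - c * step x t) ^+ 2) =
    quad beta r - 2 * c * y + c ^+ 2 * int01 (fun x => beta x * step x t).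
  rewrite quadE// /y /green /prim -int01Z; last first.
    by apply: bm_itg; apply: bmM => //; exact: bmM.
  rewrite -int01Z; last by apply: bm_itg; exact: bmM.
  have h1 : itg (fun x => beta x * tail r x ^+ 2).
    by apply: bm_itg; apply: bmM => //; exact: bmM.
  have h2 : itg (fun x => 2 * c * (beta x * tail r x * step x t)).
    apply: bm_itg; apply: bmM; first exact: bm_cst.
    by apply: bmM => //; exact: bmM.
  have h3 : itg (fun x => c ^+ 2 * (beta x * step x t)).
    by apply: bm_itg; apply: bmM; [exact: bm_cst | exact: bmM].
  rewrite -int01B// -int01D//; last exact: itgB.
  by apply: eq_int01 => x _; rewrite -[X in _ + c ^+ 2 * (_ * X)]stepsq; ring.
have : int01 (fun x => beta x * step x t) <= b1.
  rewrite -[leRHS]int01_cst; apply: le_int01; [|exact: itg_cst|].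
    by apply: bm_itg; exact: bmM.
  move=> x xI; have /andP[b0 bb] := beta01 xI.
  by rewrite /step; case: (x <= t); rewrite ?mulr1// mulr0 ltW.
set B := int01 _ => Bb h.
have {}h : 0 <= quad beta r - 2 * c * y + c ^+ 2 * b1.
  by apply: (le_trans h); rewrite lerD2l ler_wpM2l// sqr_ge0.
have e : quad beta r - 2 * c * y + c ^+ 2 * b1 = (b1 * quad beta r - y ^+ 2) / b1.
  by rewrite /c; field; rewrite gt_eqF.
by move: h; rewrite e pmulr_lge0 ?invr_gt0// subr_ge0.
Qed.

Section fixpoint.
Variable F : R -> R -> R.
Hypothesis Fbm : forall v, bm v -> bm (fun t => F t (v t)).
Hypothesis Fanti : forall t x y, 0 < t < 1 -> x <= y -> F t y <= F t x.
Hypothesis Flip : forall t x y, 0 < t < 1 -> `|F t x - F t y| <= `|x - y|.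

(** One damped step multiplies [quad] by at most [(1 - tau)^2 + tau^2 b1^2]. This [tau] minimizes
    that factor, with minimum [b1^2 * tau < 1]. *)
Let tau := (1 + b1 ^+ 2)^-1.

(* [F] being antitone and 1-Lipschitz, the damped iteration contracts the
   energy seminorm, though not the uniform norm. *)
Lemma damped_step_contract r0 r1 r2 : bm r0 -> bm r1 -> bm r2 ->
  (forall t, r1 t = (1 - tau) * r0 t + tau * F t (green beta r0 t)) ->
  (forall t, r2 t = (1 - tau) * r1 t + tau * F t (green beta r1 t)) ->
  quad beta (fun t => r2 t - r1 t) <=
    b1 ^+ 2 * tau * quad beta (fun t => r1 t - r0 t).
Proof.
move=> h0 h1 h2 r1E r2E.
have tau0 : 0 < tau by rewrite invr_gt0 ltr_pwDl// sqr_ge0.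
have tau1 : tau < 1.
  have b20 : 0 < 1 + b1 ^+ 2 by rewrite ltr_pwDl// sqr_ge0.
  by rewrite /tau invf_lt1// ltrDl exprn_gt0.
have [d dE] : exists d, d = fun t => r1 t - r0 t by eexists.
have [e eE] : exists e, e = fun t => F t (green beta r1 t) - F t (green beta r0 t).
  by eexists.
have hd : bm d by rewrite dE; exact: bmB.
have he : bm e by rewrite eE; apply: bmB; apply: Fbm; exact: green_bm.
have gd t : green beta d t = green beta r1 t - green beta r0 t.
  by rewrite dE greenB.
have -> : (fun t => r2 t - r1 t) = fun t => (1 - tau) * d t + tau * e t.
  by apply/funext => t; rewrite r2E dE eE [X in _ - X = _]r1E; ring.
rewrite -dE quad_lin//.
have neg : int01 (fun t => e t * green beta d t) <= 0.
  rewrite -[leRHS]int01_cst; apply: le_int01; [|exact: itg_cst|].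
    by apply: bm_itg; apply: bmM => //; exact: green_bm.
  move=> t tI; rewrite gd eE.
  exact: mulB_antitone_le0 (fun y z => Fanti tI).
(* A detour through the uniform norm: pointwise [|e|] is at most [|green beta d|], hence at most the
   square root of [b1 * quad beta d] by [green_sqr_le], and [quad_le] returns to the energy. *)
have qe : quad beta e <= b1 * (b1 * quad beta d).
  have q0 : 0 <= b1 * quad beta d by rewrite mulr_ge0 ?quad_ge0// ltW.
  rewrite -[b1 * quad _ d]sqr_sqrtr//; apply: quad_le => // t tI.
  rewrite eE (le_trans (Flip _ _ tI))// -gd -sqrtr_sqr ler_sqrt//.
  exact: green_sqr_le.
have qd := quad_ge0 hd.
have -> : b1 ^+ 2 * tau * quad beta d = (1 - tau) ^+ 2 * quad beta d +
   tau ^+ 2 * (b1 * (b1 * quad beta d)).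
  by rewrite /tau; field; rewrite gt_eqF// ltr_pwDl// sqr_ge0.
rewrite lerD// ?ler_wpM2l ?sqr_ge0// gerDl.
by rewrite mulr_ge0_le0// mulr_ge0 ?mulr_ge0 ?subr_ge0 ?ltW.
Qed.

(** As [beta] may vanish, [quad] need not separate loads. The limit is therefore taken of the states
    [k n = green beta (rho n)], which [green_sqr_le] makes converge uniformly, and the load is
    recovered as [F] of the limit. *)
Lemma green_fixpoint :
  exists2 r, bm r & forall t, 0 < t < 1 -> r t = F t (green beta r t).
Proof.
have tau0 : 0 < tau by rewrite invr_gt0 ltr_pwDl// sqr_ge0.
have [rho [rho0 rhoS]] : exists rho : nat -> R -> R, bm (rho 0) /\
    forall n t, rho n.+1 t = (1 - tau) * rho n t + tau * F t (green beta (rho n) t).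
  exists (fun n => iter n (fun r t => (1 - tau) * r t + tau * F t (green beta r t))
                          (fun=> 0)).
  by split => //; exact: bm_cst.
have hrho n : bm (rho n).
  elim: n => // n IH.
  have -> : rho n.+1 = fun t => (1 - tau) * rho n t + tau * F t (green beta (rho n) t).
    by apply/funext.
  apply: bmD; first by apply: bmM => //; exact: bm_cst.
  by apply: bmM; [exact: bm_cst | apply: Fbm; exact: green_bm].
have [k kE] : exists k, forall n, k n = green beta (rho n) by eexists.
have hk m : bm (k m) by rewrite kE; exact: green_bm.
have [q qE] : exists q, forall n, q n = quad beta (fun t => rho n.+1 t - rho n t).
  by eexists.
have hd m : bm (fun t => rho m.+1 t - rho m t) by exact: bmB.
have q_ge0 n : 0 <= q n by rewrite qE quad_ge0.
have qS n : q n.+1 <= b1 ^+ 2 * tau * q n.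
  by rewrite !qE; apply: damped_step_contract.
(* The energy is quadratic, so the states contract by the square root of its factor. *)
have [gam [g01 g2]] : exists gam, 0 <= gam < 1 /\ gam ^+ 2 = b1 ^+ 2 * tau.
  exists (Num.sqrt (b1 ^+ 2 * tau)); split.
    rewrite sqrtr_ge0/= -[ltRHS]sqrtr1 ltr_sqrt// /tau.
    by rewrite ltr_pdivrMr ?mul1r ?ltrDr// ltr_pwDl// sqr_ge0.
  by rewrite sqr_sqrtr// mulr_ge0 ?sqr_ge0 ?ltW.
have [g0 g1] := andP g01.
have qn n : q n <= gam ^+ (2 * n) * q 0.
  elim: n => [|n IH]; first by rewrite muln0 expr0 mul1r.
  rewrite (le_trans (qS n))// -g2 mulnS exprD -mulrA.
  by rewrite ler_wpM2l// sqr_ge0.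
have [C [C0 C2]] : exists C, 0 <= C /\ C ^+ 2 = b1 * q 0.
  exists (Num.sqrt (b1 * q 0)); split; first exact: sqrtr_ge0.
  by rewrite sqr_sqrtr// mulr_ge0// ltW.
have kstep n t : `|k n.+1 t - k n t| <= C * gam ^+ n.
  rewrite !kE -greenB//.
  rewrite -ler_sqr ?nnegrE ?mulr_ge0 ?exprn_ge0//.
  rewrite real_normK ?num_real// (le_trans (green_sqr_le _ (hd n)))// -qE.
  rewrite exprMn C2 -exprM [(n * 2)%N]mulnC -mulrA [q 0 * _]mulrC.
  by rewrite ler_wpM2l// ltW.
have lims t : exists l, k^~ t @ \oo --> l /\
    forall n, `|l - k n t| <= C / (1 - gam) * gam ^+ n.
  by have [l h1 h2] := geometric_increments_cvg g01 (kstep^~ t); exists l.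
have [kl hkl] := choice lims.
have [D DE] : exists D, D = C / (1 - gam) by eexists.
have D0 : 0 <= D by rewrite DE divr_ge0// subr_ge0 ltW.
have {}hkl t : k^~ t @ \oo --> kl t /\ forall n, `|kl t - k n t| <= D * gam ^+ n.
  by rewrite DE; exact: hkl.
have bkl : bm kl.
  split.
    apply: (measurable_fun_cvg (h := k)) => [m|t tI]; first exact: (hk m).1.
    exact: (hkl t).1.
  have [M hM] := (hk 0).2; exists (D + M) => t tI.
  have := (hkl t).2 0; rewrite expr0 mulr1 => h.
  rewrite -[kl t](subrK (k 0 t)) (le_trans (ler_normD _ _))// lerD//.
  exact: hM.
have hF v : bm v -> bm (fun t => F t (v t)) by exact: Fbm.
exists (fun t => F t (kl t)); first exact: hF.
move=> t tI; congr F; apply/esym/eqP.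
rewrite -subr_eq0 -normr_eq0; apply/eqP.
(* The defect of the limit is independent of [n] but bounded by a multiple of [gam ^+ n]. The three
   constants come from replacing the limit by [k n] inside [F], from the increment [k n.+1 - k n],
   which is [tau] times the defect of [k n], and from replacing [k n] by the limit. *)
apply: (@le_geometric_eq0 _ _ (b1 * D + C / tau + D) gam) => // n.
have hfk : bm (fun x => F x (k n x)) by exact: hF.
have hfl := hF _ bkl.
set G1 := green _ _ t; set G2 := green beta (fun x => F x (k n x)) t.
have -> : G1 - kl t = (G1 - G2) + (G2 - k n t) + (k n t - kl t) by ring.
rewrite !mulrDl (le_trans (ler_normD _ _))// lerD//; last first.
  by rewrite distrC; exact: (hkl t).2.
rewrite (le_trans (ler_normD _ _))// lerD//.
  rewrite -greenB// -mulrA; apply: norm_green; first exact: bmB.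
  by move=> x xI; rewrite (le_trans (Flip _ _ xI))//; exact: (hkl x).2.
have -> : G2 - k n t = (k n.+1 t - k n t) / tau.
  have -> : k n.+1 t = (1 - tau) * k n t + tau * G2.
    have e1 : bm (fun t => (1 - tau) * rho n t) by apply: bmM => //; exact: bm_cst.
    have e2 : bm (fun t => tau * F t (k n t)) by apply: bmM => //; exact: bm_cst.
    rewrite [in RHS]kE /G2 -!greenZ// -greenD// kE.
    by apply: (congr1 (@^~ t)); apply: eq_green => x _; rewrite rhoS kE.
  by field; rewrite gt_eqF.
have ti : 0 <= tau^-1 by rewrite invr_ge0 ltW.
by rewrite normrM [`|tau^-1|]ger0_norm// [C / tau * _]mulrAC ler_wpM2r.
Qed.

End fixpoint.
End bounded_weight.
End green.

(** * Elementary bounds *)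

Section trigonometric_bounds.
Context {R : realType}.
Implicit Types x y : R.

Lemma lipschitz_derive (f df : R -> R) (C : R) :
  (forall x, is_derive x 1 f (df x)) -> (forall x, `|df x| <= C) ->
  forall x y, `|f y - f x| <= C * `|y - x|.
Proof.
move=> fdf dfC; suff h x y : x <= y -> `|f y - f x| <= C * `|y - x|.
  move=> x y; have [|/ltW] := leP x y; first exact: h.
  by move=> /h; rewrite distrC [X in _ * X]distrC.
move=> xy; have cf : continuous f.
  move=> z; apply: differentiable_continuous; apply/derivable1_diffP.
  exact: ex_derive.
have [c _ ->] := MVT_segment xy (fun z _ => fdf z) (continuous_subspaceT cf).
by rewrite normrM ler_wpM2r.
Qed.

(** Using the mean value theorem twice gives the constant 1 in place of 1/2, which is enough for a
    quadratic remainder. *)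
Lemma taylor1_derive (f df ddf : R -> R) :
  (forall x, is_derive x 1 f (df x)) -> (forall x, is_derive x 1 df (ddf x)) ->
  (forall x, `|ddf x| <= 1) ->
  forall x y, `|f y - f x - df x * (y - x)| <= (y - x) ^+ 2.
Proof.
move=> fdf dfd ddf1 x y; have cf : continuous f.
  move=> z; apply: differentiable_continuous; apply/derivable1_diffP.
  exact: ex_derive.
have key u v w z : u <= w <= v -> z = u \/ z = v ->
  `|df w * (v - u) - df z * (v - u)| <= (v - u) ^+ 2.
  move=> /andP[uw wv] zuv.
  rewrite -mulrBl normrM [X in _ * X]ger0_norm; last by rewrite subr_ge0 (le_trans uw).
  rewrite expr2 ler_wpM2r ?subr_ge0 ?(le_trans uw)//.
  have := lipschitz_derive dfd ddf1 z w; rewrite mul1r => /le_trans; apply.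
  by case: zuv => ->; rewrite ler_norml; lra.
have [xy|/ltW yx] := leP x y.
  have [c] := MVT_segment xy (fun z _ => fdf z) (continuous_subspaceT cf).
  by rewrite in_itv/= => cxy ->; apply: key => //; left.
have [c] := MVT_segment yx (fun z _ => fdf z) (continuous_subspaceT cf).
rewrite in_itv/= => cxy e.
have -> : f y - f x - df x * (y - x) = - (df c * (x - y) - df x * (x - y)).
  by rewrite -e; ring.
rewrite normrN; have -> : (y - x) ^+ 2 = (x - y) ^+ 2 by ring.
by apply: key => //; right.
Qed.

Lemma cos_lipschitz x y : `|cos y - cos x| <= `|y - x|.
Proof.
rewrite -[leRHS]mul1r; apply: (@lipschitz_derive _ (fun z => - sin z)) => z.
by rewrite normrN; exact: sin_max.
Qed.

Lemma sin_taylor x y : `|sin y - sin x - cos x * (y - x)| <= (y - x) ^+ 2.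
Proof.
apply: (@taylor1_derive _ _ (fun z => - sin z)) => z.
by rewrite normrN; exact: sin_max.
Qed.

Lemma cos_taylor x y : `|cos y - cos x + sin x * (y - x)| <= (y - x) ^+ 2.
Proof.
rewrite -[sin x * _]opprK -mulNr.
apply: (@taylor1_derive _ (fun z => - sin z) (fun z => - cos z)) => z.
by rewrite normrN; exact: cos_max.
Qed.

Lemma le_cos x y : 0 <= x -> x <= y -> y <= pi -> cos y <= cos x.
Proof.
move=> x0; rewrite le_eqVlt => /predU1P[->//|xy] ypi; apply/ltW.
by rewrite ltr_cos// in_itv/= ?x0 ?ypi ?andbT ?(le_trans (ltW xy) ypi)// (le_trans x0 (ltW xy)).
Qed.

Lemma le_sin x y : - (pi / 2) <= x -> x <= y -> y <= pi / 2 -> sin x <= sin y.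
Proof.
move=> x0; rewrite le_eqVlt => /predU1P[->//|xy] ypi; apply/ltW.
by rewrite ltr_sin// in_itv/= ?x0 ?ypi ?andbT ?(le_trans (ltW xy) ypi)// (le_trans x0 (ltW xy)).
Qed.

Lemma bm_continuous_comp (f u : R -> R) : continuous f ->
  (forall x, `|f x| <= 1) -> bm u -> bm (fun t => f (u t)).
Proof.
move=> cf f1 [mu1 _]; split; last by exists 1.
exact: (measurableT_comp (continuous_measurable_fun cf)).
Qed.

Lemma bm_cos (u : R -> R) : bm u -> bm (fun t => cos (u t)).
Proof. by apply: bm_continuous_comp; [exact: continuous_cos | exact: cos_max]. Qed.

Lemma bm_sin (u : R -> R) : bm u -> bm (fun t => sin (u t)).
Proof. by apply: bm_continuous_comp; [exact: continuous_sin | exact: sin_max]. Qed.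

Definition clamp (lo hi x : R) := Num.max lo (Num.min x hi).

Lemma clamp_itv lo hi x : lo <= hi -> lo <= clamp lo hi x <= hi.
Proof. by move=> lh; rewrite /clamp le_max lexx ge_max lh ge_min lexx orbT. Qed.

Lemma clamp_id lo hi x : lo <= x <= hi -> clamp lo hi x = x.
Proof.
by move=> /andP[lx xh]; rewrite /clamp (min_idPl xh) (max_idPr lx).
Qed.

Lemma le_clamp lo hi x y : x <= y -> clamp lo hi x <= clamp lo hi y.
Proof.
move=> xy; rewrite /clamp ge_max le_max lexx/= le_max; apply/orP; right.
by rewrite le_min ge_min xy/= ge_min lexx orbT.
Qed.

Lemma clamp_lipschitz lo hi x y : `|clamp lo hi x - clamp lo hi y| <= `|x - y|.
Proof.
have h u v : u <= v -> clamp lo hi v - clamp lo hi u <= v - u.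
  move=> uv; rewrite lerBlDl /clamp ge_max; apply/andP; split.
    have : lo <= Num.max lo (Num.min u hi) by rewrite le_max lexx.
    by lra.
  have : Num.min u hi <= Num.max lo (Num.min u hi) by rewrite le_max lexx orbT.
  suff : Num.min v hi <= Num.min u hi + (v - u) by lra.
  have v1 : Num.min v hi <= v by rewrite ge_min lexx.
  have v2 : Num.min v hi <= hi by rewrite ge_min lexx orbT.
  by have [|] := leP u hi; lra.
have [xy|/ltW yx] := leP x y.
  rewrite distrC [leRHS]distrC !ger0_norm ?subr_ge0// ?le_clamp//; exact: h.
by rewrite !ger0_norm ?subr_ge0// ?le_clamp//; exact: h.
Qed.

Lemma bm_clamp lo hi (u : R -> R) : bm u -> bm (fun t => clamp lo hi (u t)).
Proof.
move=> [mu1 [C uC]]; split.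
  have m1 := measurable_minr mu1 (measurable_cst hi).
  exact: (measurable_maxr (measurable_cst lo) m1).
exists (`|lo| + C + `|hi|) => t tI.
have := uC t tI; rewrite /clamp; have C0 := le_trans (normr_ge0 _) (uC t tI).
have := normr_ge0 lo; have := normr_ge0 hi.
by rewrite /Order.max /Order.min; repeat case: ifP => _; lra.
Qed.

End trigonometric_bounds.

(** * First and last zeros of Lipschitz functions *)

Section first_times.
Context {R : realType}.
Implicit Types (g : R -> R) (x y : R).

Definition lip01 g := exists2 L, 0 < L &
  forall s t, 0 <= s <= t -> t <= 1 -> `|g t - g s| <= L * (t - s).

Lemma bm_bound (v : R -> R) : bm v ->
  exists2 C, 0 < C & forall t, 0 < t < 1 -> `|v t| <= C.
Proof.
move=> [_ [C hC]]; exists (`|C| + 1); first by rewrite ltr_wpDl.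
move=> t; rewrite -unit_itvE => /hC /le_trans; apply.
by rewrite (le_trans (ler_norm _))// lerDl.
Qed.

Lemma prim_lip01 (v : R -> R) : bm v -> lip01 (prim v).
Proof.
move=> hv; have [C C0 vC] := bm_bound hv; exists C => // s t st t1.
rewrite ler_norml -mulNr; apply/andP; split.
  apply: prim_incr_ge => //; first exact: bm_itg.
  by move=> x /vC; rewrite ler_norml => /andP[].
apply: prim_incr_le => //; first exact: bm_itg.
by move=> x /vC; rewrite ler_norml => /andP[].
Qed.

Lemma tail_lip01 (v : R -> R) : bm v -> lip01 (tail v).
Proof.
move=> hv; have [L L0 h] := prim_lip01 hv; exists L => // s t st t1.
rewrite !tail_prim; [|exact: bm_itg..].
have -> : int01 v - prim v t - (int01 v - prim v s) = - (prim v t - prim v s) by ring.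
by rewrite normrN h.
Qed.

Lemma lip01N g : lip01 g -> lip01 (fun t => - g t).
Proof.
move=> [L L0 h]; exists L => // s t st t1.
by rewrite -opprD normrN h.
Qed.

Lemma lip01Bcst g c : lip01 g -> lip01 (fun t => g t - c).
Proof.
move=> [L L0 h]; exists L => // s t st t1.
have -> : g t - c - (g s - c) = g t - g s by ring.
exact: h.
Qed.

(** The witness is the infimum of the times in [[x, y]] with [g >= 0]. Such times accumulate at it,
    which excludes [g < 0] there; [g] is negative just before it, which excludes [g > 0]. *)
Lemma first_nonneg g x y : lip01 g -> 0 <= x -> x <= y -> y <= 1 ->
  g x < 0 -> 0 <= g y ->
  exists e, [/\ x < e, e <= y, g e = 0 & forall t, x <= t -> t < e -> g t < 0].
Proof.
move=> [L L0 gL] x0 xy y1 gx gy.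
pose E := [set t | x <= t <= y /\ 0 <= g t].
have Ey : E y by split; rewrite ?xy ?lexx.
have lbE : lbound E x by move=> t [/andP[]].
have hE : has_inf E by split; [exists y | exists x].
have xe : x <= inf E by apply: lb_le_inf => //; exists y.
have ey : inf E <= y by apply: ge_inf => //; exists x.
have ge : 0 <= g (inf E).
  rewrite leNgt; apply/negP => ge0.
  have d0 : 0 < - g (inf E) / L by rewrite divr_gt0// oppr_gt0.
  have [u [/andP[xu uy] gu]] := inf_adherent d0 hE.
  have eu : inf E <= u by apply: ge_inf; [exists x | split; rewrite ?xu].
  rewrite -ltrBlDl ltr_pdivlMr// => h.
  have := gL (inf E) u; rewrite (le_trans x0 xe) eu => /(_ isT (le_trans uy y1)).
  by move=> /(le_trans (ler_norm _)); lra.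
have xe' : x < inf E.
  by rewrite lt_neqAle xe andbT; apply/eqP => xE; move: gx; rewrite ltNge xE ge.
have gneg t : x <= t -> t < inf E -> g t < 0.
  move=> xt te; rewrite ltNge; apply/negP => gt.
  move: (te); rewrite ltNge => /negP; apply; apply: ge_inf; first by exists x.
  by split => //; rewrite xt (le_trans (ltW te) ey).
exists (inf E); split => //; apply/eqP; rewrite eq_le ge andbT leNgt.
(* Going back by at most [d] costs at most half of [g (inf E)], so [g] would still be positive
   before the infimum. *)
apply/negP => gpos; pose d := g (inf E) / (2 * L).
have d0 : 0 < d by rewrite divr_gt0// mulr_gt0.
pose t := Num.max x (inf E - d).
have te : t < inf E by rewrite gt_max xe' gtrBl.
have xt : x <= t by rewrite le_max lexx.
have td : inf E - t <= d.
  by rewrite lerBlDl -lerBlDr le_max lexx orbT.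
have := gL t (inf E); rewrite (le_trans x0 xt) (ltW te) => /(_ isT (le_trans ey y1)).
move=> /(le_trans (ler_norm _)) h1.
have h2 : L * (inf E - t) <= L * d by rewrite ler_wpM2l// ltW.
have h3 : L * d = g (inf E) / 2 by rewrite /d; field; rewrite gt_eqF.
by have := gneg t xt te; lra.
Qed.

(** This is [first_nonneg] after the time reversal [t -> 1 - t]. *)
Lemma last_nonneg g x y : lip01 g -> 0 <= x -> x <= y -> y <= 1 ->
  0 <= g x -> g y < 0 ->
  exists s, [/\ x <= s, s < y, g s = 0 & forall t, s < t -> t <= y -> g t < 0].
Proof.
move=> [L L0 gL] x0 xy y1 gx gy.
have rlip : lip01 (fun t => g (1 - t)).
  exists L => // s t /andP[s0 st] t1; rewrite distrC.
  have -> : t - s = 1 - s - (1 - t) by ring.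
  by apply: gL; lra.
have [|||||e [ye ex ge h]] := @first_nonneg _ (1 - y) (1 - x) rlip.
- lra.
- lra.
- lra.
- by have -> : 1 - (1 - y) = y by ring.
- by have -> : 1 - (1 - x) = x by ring.
exists (1 - e); split; [lra|lra|by []|].
move=> t et ty; have -> : t = 1 - (1 - t) by ring.
by apply: h; lra.
Qed.

End first_times.

(** * The state equation in integral form *)

Section beam.
Context {R : realType}.
Implicit Types (t x : R).

(* In terms of k = - K, [tail (bending k)] is the bending moment - A(theta) K'. *)
Definition bending (k : R -> R) (t : R) := (1 - t) * cos (k t).

Definition beam_angle (beta k : R -> R) :=
  [/\ bm k, forall t, 0 <= t <= 1 -> k t = green beta (bending k) t
    & forall t, 0 <= t < 1 -> 0 <= k t < pi / 2].

Lemma bm_load : bm (fun t : R => 1 - t).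
Proof. by apply: bmB; [exact: bm_cst | exact: bm_id]. Qed.

Lemma bm_bending k : bm k -> bm (bending k).
Proof. by move=> hk; apply: bmM; [exact: bm_load | exact: bm_cos]. Qed.

Lemma pihalf_gt0 : 0 < pi / 2 :> R.
Proof. by rewrite divr_gt0 ?pi_gt0. Qed.

Section weight.
Variables (beta : R -> R) (b1 : R).
Hypotheses (hb : bm beta) (b1_gt0 : 0 < b1).
Hypothesis beta01 : forall t, 0 < t < 1 -> 0 <= beta t <= b1.

(* Outside [0, pi/2] the cosine is frozen, which makes the equation monotone. *)
Let F t x := (1 - t) * cos (clamp 0 (pi / 2) x).

Let Fbm v : bm v -> bm (fun t => F t (v t)).
Proof. by move=> hv; apply: bmM; [exact: bm_load | apply: bm_cos; exact: bm_clamp]. Qed.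

Let Fanti t x y : 0 < t < 1 -> x <= y -> F t y <= F t x.
Proof.
move=> /andP[t0 t1] xy; rewrite ler_wpM2l ?subr_ge0 ?(ltW t1)//.
have h := ltW pihalf_gt0; have p0 := pi_gt0 R.
have /andP[hx _] := clamp_itv x h; have /andP[_ hy] := clamp_itv y h.
by apply: le_cos => //; [exact: le_clamp | rewrite (le_trans hy)//; lra].
Qed.

Let Flip t x y : 0 < t < 1 -> `|F t x - F t y| <= `|x - y|.
Proof.
move=> /andP[t0 t1]; rewrite -mulrBr normrM (ger0_norm (_ : 0 <= 1 - t)); last first.
  by rewrite subr_ge0 ltW.
apply: (le_trans _ (clamp_lipschitz 0 (pi / 2) x y)).
apply: (le_trans _ (cos_lipschitz _ _)).
by rewrite ler_piMl// gerBl ltW.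
Qed.

Lemma green_mono r : bm r -> (forall t, 0 < t < 1 -> 0 <= r t) ->
  forall s t, 0 <= s <= t -> t <= 1 -> green beta r s <= green beta r t.
Proof.
move=> hr r0 s t st t1; rewrite -subr_ge0 -[leLHS](mul0r (t - s)).
apply: prim_incr_ge => //; first by apply: bm_itg; exact: bm_beta_tail.
move=> x xI _; have /andP[bx _] := beta01 xI; rewrite mulr_ge0//.
by apply: int01_ge0 => y yI; rewrite mulr_ge0 ?r0// /step; case: (x <= y).
Qed.

Lemma cos_clamp_ge0 x : 0 <= cos (clamp 0 (pi / 2) x).
Proof.
apply: cos_ge0_pihalf; have h := ltW pihalf_gt0.
by have /andP[h1 ->] := clamp_itv x h; rewrite andbT (le_trans _ h1)// oppr_le0.
Qed.

Lemma beam_angle_exists : exists k, beam_angle beta k.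
Proof.
have [r hr er] := green_fixpoint hb b1_gt0 beta01 Fbm Fanti Flip.
have b1_pos := b1_gt0.
have [k kE] : exists k, k = green beta r by eexists.
rewrite -kE in er.
have hk : bm k by rewrite kE; exact: green_bm.
have k0 : k 0 = 0 by rewrite kE /green prim0.
have r0 t : 0 < t < 1 -> 0 <= r t.
  move=> tI; rewrite er// mulr_ge0 ?cos_clamp_ge0// subr_ge0 ltW//.
  by case/andP: tI.
have kmono s t : 0 <= s <= t -> t <= 1 -> k s <= k t.
  by rewrite kE; exact: green_mono.
have kge0 t : 0 <= t <= 1 -> 0 <= k t.
  by move=> /andP[t0 t1]; rewrite -k0 kmono// lexx.
have klip : lip01 k by rewrite kE; apply: prim_lip01; exact: bm_beta_tail.
have klt t : 0 <= t <= 1 -> k t < pi / 2.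
  move=> /andP[t0 t1]; rewrite ltNge; apply/negP => kt.
  have [|||||e [e0 et ke hlt]] := @first_nonneg _ (fun t => k t - pi / 2) 0 t (lip01Bcst _ klip).
  - by [].
  - by [].
  - by [].
  - by rewrite k0 sub0r oppr_lt0 pihalf_gt0.
  - by rewrite subr_ge0.
  have e1 := le_trans et t1.
  have tle : tail r e <= 0.
    suff : tail r e - tail r 1 <= 0 * (1 - e) by rewrite tail1 mul0r subr0.
    apply: tail_decr_le => //; first exact: bm_itg.
      by rewrite (ltW e0).
    move=> x xI /andP[ex x1]; rewrite er// /F.
    have kx : pi / 2 <= k x.
      by rewrite -subr_ge0 -ke lerD2r kmono// (ltW e0) ltW.
    by rewrite /clamp (min_idPr kx) (max_idPr (ltW pihalf_gt0)) cos_pihalf mulr0.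
  (* Over a time [l] the load is at most [D], the drop of [k], so the moment is at most [D * l] and
     the drop at most [b1 * l^2 * D]. The choice of [l] makes [b1 * l^2 < 1], hence [D < D]. *)
  pose l := (1 + b1)^-1.
  have l0 : 0 < l by rewrite invr_gt0 ltr_wpDr // ltW.
  have bl : b1 * l ^+ 2 < 1.
    have b1' : 0 < 1 + b1 by lra.
    rewrite /l exprVn ltr_pdivrMr ?exprn_gt0// mul1r.
    have : 0 < b1 ^+ 2 by rewrite exprn_gt0.
    by rewrite sqrrD expr1n mul1r mulr2n; lra.
  pose s := Num.max 0 (e - l).
  have s0 : 0 <= s by rewrite le_max lexx.
  have sl : e - l <= s by rewrite le_max lexx orbT.
  have se : s < e by rewrite gt_max e0 gtrBl.
  have [D DE] : exists D, D = k e - k s by eexists.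
  have D0 : 0 < D by rewrite DE subr_gt0; have := hlt s s0 se; lra.
  have tlu u : s <= u -> u <= e -> tail r u <= D * l.
    move=> su ue; rewrite -[leLHS](subrK (tail r e)).
    have : tail r u - tail r e <= D * (e - u).
      apply: tail_decr_le => //; first exact: bm_itg.
        by rewrite (le_trans s0 su).
      move=> x xI /andP[ux xe]; have x01 : 0 <= x <= 1.
        by case/andP: xI => x0 x1; rewrite !ltW.
      have kx : k x <= k e by apply: kmono => //; case/andP: x01 => ->.
      have ksx : k s <= k x.
        by apply: kmono; [rewrite s0/= (le_trans su (ltW ux)) | case/andP: x01].
      rewrite er// /F; have [x0 x1] := andP xI.
      rewrite (le_trans (_ : _ <= cos (clamp 0 (pi / 2) (k x))))//.
        by rewrite ler_piMl ?cos_clamp_ge0// gerBl ltW.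
      have [kpi|kpi] := leP (k x) (pi / 2).
        rewrite clamp_id ?kge0//.
        have := cos_lipschitz (pi / 2) (k x).
        rewrite cos_pihalf subr0 => /(le_trans (ler_norm _)).
        by rewrite ler0_norm ?subr_le0// => h; rewrite DE; move: ke; lra.
      rewrite /clamp (min_idPr (ltW kpi)) (max_idPr (ltW pihalf_gt0)) cos_pihalf.
      exact: ltW.
    have : D * (e - u) <= D * l by rewrite ler_wpM2l ?(ltW D0)//; lra.
    by move: tle; lra.
  have : D <= b1 * (D * l) * (e - s).
    rewrite {1}DE kE; apply: prim_incr_le => //.
    - by apply: bm_itg; exact: bm_beta_tail.
    - by rewrite s0 ltW.
    move=> x xI /andP[sx xe]; have /andP[bx0 bx1] := beta01 xI.
    rewrite (le_trans (_ : _ <= beta x * (D * l)))//.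
      by rewrite ler_wpM2l// tlu// ltW.
    by rewrite ler_wpM2r// mulr_ge0// ltW.
  have : b1 * (D * l) * (e - s) <= b1 * (D * l) * l.
    have h : 0 <= b1 * (D * l) by apply: mulr_ge0; [|apply: mulr_ge0]; exact: ltW.
    by rewrite ler_wpM2l//; move: sl; lra.
  have : b1 * (D * l) * l < D.
    have -> : b1 * (D * l) * l = b1 * l ^+ 2 * D by ring.
    by rewrite gtr_pMl.
  by lra.
exists k; split => //.
- move=> t t01; transitivity (green beta r t); first by rewrite kE.
  apply: (congr1 (@^~ t)); apply: eq_green => x xI; rewrite er// /F clamp_id//.
  by case/andP: xI => x0 x1; rewrite kge0 ?ltW// klt// !ltW.
- by move=> t /andP[t0 t1]; rewrite kge0 ?klt// t0 ltW.
Qed.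

End weight.
End beam.

(** * The adjoint state and the switching function *)

Section adjoint.
Context {R : realType}.
Implicit Types (t x : R).
Variables (beta k : R -> R) (b1 : R).
Hypotheses (hb : bm beta) (b1_gt0 : 0 < b1).
Hypothesis beta01 : forall t, 0 < t < 1 -> 0 <= beta t <= b1.
Hypothesis hk : beam_angle beta k.

Let kbm : bm k. Proof. by case: hk. Qed.

Let k_itv t : 0 <= t < 1 -> 0 <= k t < pi / 2.
Proof. by case: hk => _ _; exact. Qed.

Lemma cos_angle_gt0 t : 0 <= t < 1 -> 0 < cos (k t).
Proof.
move=> /k_itv /andP[k0 k1]; apply: cos_gt0_pihalf; rewrite k1 andbT.
by rewrite (lt_le_trans _ k0)// oppr_lt0 pihalf_gt0.
Qed.

Lemma sin_angle_ge0 t : 0 <= t < 1 -> 0 <= sin (k t).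
Proof.
move=> /k_itv /andP[k0 k1]; apply: sin_ge0_pi; rewrite k0/=.
by have := pi_gt0 R; move: k1; lra.
Qed.

Lemma bending_ge0 t : 0 < t < 1 -> 0 <= bending k t.
Proof.
move=> /andP[t0 t1]; rewrite /bending mulr_ge0 ?subr_ge0 ?(ltW t1)//.
by rewrite ltW// cos_angle_gt0// (ltW t0).
Qed.

Lemma beam_angle_mono s t : 0 <= s <= t -> t <= 1 -> k s <= k t.
Proof.
move=> st t1; have [_ ek _] := hk; have [s0 s_t] := andP st.
have s01 : 0 <= s <= 1 by rewrite s0 (le_trans s_t).
have t01 : 0 <= t <= 1 by rewrite (le_trans s0).
rewrite (ek _ s01) (ek _ t01); apply: (green_mono hb beta01) => //.
  exact: bm_bending.
exact: bending_ge0.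
Qed.

(** The term [cos k] is the derivative of the cost density [sin k], and [- sin k * p] is the
    linearized bending load applied to [p]; the linearized state operator is its own adjoint because
    the Green operator is symmetric. *)
Definition adjoint_load (p : R -> R) t := (1 - t) * (cos (k t) - sin (k t) * p t).

(** Since [sin k >= 0] and [(1 - t) * sin k <= 1], this load is antitone and 1-Lipschitz in [p], as
    [green_fixpoint] demands. *)
Lemma adjoint_exists :
  exists2 r, bm r & forall t, 0 < t < 1 -> r t = adjoint_load (green beta r) t.
Proof.
apply: (@green_fixpoint _ beta b1 hb b1_gt0 beta01
  (fun t x => (1 - t) * (cos (k t) - sin (k t) * x))).
- move=> v hv; apply: bmM; first exact: bm_load.
  by apply: bmB; [exact: bm_cos | apply: bmM => //; exact: bm_sin].
- move=> t x y /andP[t0 t1] xy; rewrite ler_wpM2l ?subr_ge0 ?(ltW t1)//.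
  by rewrite lerD2l lerN2 ler_wpM2l// sin_angle_ge0// (ltW t0).
- move=> t x y /andP[t0 t1].
  have -> : (1 - t) * (cos (k t) - sin (k t) * x) -
     (1 - t) * (cos (k t) - sin (k t) * y) = (1 - t) * sin (k t) * (y - x) by ring.
  rewrite normrM [leRHS]distrC ler_piMl// normrM.
  rewrite (ger0_norm (_ : 0 <= 1 - t)) ?subr_ge0 ?(ltW t1)//.
  have := sin_max (k t); have := normr_ge0 (sin (k t)).
  by nra.
Qed.

(** * Signs and monotonicity of the adjoint angle and moment *)

Section adjoint_sign.
Variable r : R -> R.
Hypotheses (hr : bm r)
  (er : forall t, 0 < t < 1 -> r t = adjoint_load (green beta r) t).
Local Notation p := (green beta r).
Local Notation q := (tail r).

Let p_lip : lip01 p. Proof. by apply: prim_lip01; exact: bm_beta_tail. Qed.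
Let q_lip : lip01 q. Proof. exact: tail_lip01. Qed.

(** This and the next three facts are the sign rules of the system [p' = beta * q], [q' = - r] in
    integrated form. *)
Let q_noninc_of s t : 0 <= s <= t -> t <= 1 ->
  (forall x, 0 < x < 1 -> s < x <= t -> 0 <= r x) -> q t <= q s.
Proof.
move=> st t1 r0; rewrite -subr_ge0 -[leLHS](mul0r (t - s)).
by apply: tail_decr_ge => //; exact: bm_itg.
Qed.

Let q_nondec_of s t : 0 <= s <= t -> t <= 1 ->
  (forall x, 0 < x < 1 -> s < x <= t -> r x <= 0) -> q s <= q t.
Proof.
move=> st t1 r0; rewrite -subr_le0 -[leRHS](mul0r (t - s)).
by apply: tail_decr_le => //; exact: bm_itg.
Qed.

Let p_nondec_of s t : 0 <= s <= t -> t <= 1 ->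
  (forall x, 0 < x < 1 -> s < x <= t -> 0 <= q x) -> p s <= p t.
Proof.
move=> st t1 q0; rewrite -subr_ge0 -[leLHS](mul0r (t - s)).
apply: prim_incr_ge => //; first by apply: bm_itg; exact: bm_beta_tail.
by move=> x xI xst; have /andP[bx _] := beta01 xI; rewrite mulr_ge0// q0.
Qed.

Let p_noninc_of s t : 0 <= s <= t -> t <= 1 ->
  (forall x, 0 < x < 1 -> s < x <= t -> q x <= 0) -> p t <= p s.
Proof.
move=> st t1 q0; rewrite -subr_le0 -[leRHS](mul0r (t - s)).
apply: prim_incr_le => //; first by apply: bm_itg; exact: bm_beta_tail.
by move=> x xI xst; have /andP[bx _] := beta01 xI; rewrite mulr_ge0_le0// q0.
Qed.

Let r_ge0_of x : 0 < x < 1 -> p x <= 0 -> 0 <= r x.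
Proof.
move=> xI px; rewrite er//; have /andP[x0 x1] := xI.
have x01 : 0 <= x < 1 by rewrite ltW.
rewrite /adjoint_load mulr_ge0 ?subr_ge0 ?(ltW x1)//.
exact: le_trans (mulr_ge0_le0 (sin_angle_ge0 x01) px) (ltW (cos_angle_gt0 x01)).
Qed.

(** If [p x < 0], then since the last zero of [p] the load [r] is nonnegative and [q] does not
    increase; [q x >= 0] would then make [p] nondecreasing up to [x], so [q x < 0]. From [x] on
    these signs sustain each other: [p] stays negative, [r] nonnegative, and [q] cannot climb back
    to its value 0 at 1. *)
Lemma adjoint_ge0 x : 0 <= x <= 1 -> 0 <= p x.
Proof.
move=> /andP[x0 x1]; rewrite leNgt; apply/negP => px.
have p0 : p 0 = 0 by rewrite /green prim0.
have [|||||s [s0 sx ps hs]] := @last_nonneg _ p 0 x p_lip => //.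
  by rewrite p0.
have qx : q x < 0.
  rewrite ltNge; apply/negP => qx; move: px; rewrite ltNge => /negP; apply.
  rewrite -ps; apply: p_nondec_of => //; first by rewrite s0 ltW.
  move=> y _ /andP[sy yx]; apply: (le_trans qx); apply: q_noninc_of => //.
    by rewrite yx (le_trans s0 (ltW sy)).
  move=> z zI /andP[yz zx]; apply: r_ge0_of => //; apply/ltW/hs => //.
  exact: lt_trans yz.
have q1 : q 1 = 0 by rewrite tail1.
have [|||e [xe e1 qe he]] := @first_nonneg _ q x 1 q_lip x0 x1 => //.
  by rewrite q1.
have pneg u : x <= u -> u <= e -> p u <= 0.
  move=> xu ue; apply: le_trans (ltW px); apply: p_noninc_of.
  - by rewrite x0.
  - by rewrite (le_trans ue).
  move=> y _ /andP[xy yu]; have := le_trans yu ue.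
  by rewrite le_eqVlt => /predU1P[->|ye]; [rewrite qe | apply/ltW/he => //; exact: ltW].
have : q e <= q x.
  apply: q_noninc_of => //; first by rewrite x0 ltW.
  by move=> y yI /andP[xy ye]; apply: r_ge0_of => //; apply: pneg => //; exact: ltW.
by rewrite qe leNgt qx.
Qed.

(* On an interval where [q > 0] the adjoint [p] grows, so [cos k - p sin k] can
   only change sign from plus to minus; past such a change [q] would increase
   and never come back to [0]. *)
Let q_noninc_pos s x : 0 <= s <= x -> x <= 1 ->
  (forall t, s < t -> t <= x -> 0 < q t) ->
  forall t t', s <= t -> t <= t' -> t' <= x -> q t' <= q t.
Proof.
move=> /andP[s0 sx] x1 qpos t t' st tt' t'x.
have [xs|xs] := leP x s.
  by have -> : t' = t by apply/eqP; rewrite eq_le tt' andbT (le_trans t'x)// (le_trans xs).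
have qx := qpos x xs (lexx _).
have x0 := le_trans s0 sx.
have [|||e [xe e1 qe he]] := @first_nonneg _ (fun t => - q t) x 1 (lip01N q_lip) x0 x1.
- by [].
- by rewrite oppr_lt0.
- by rewrite tail1 oppr0.
have {}qe : q e = 0 by apply/eqP; rewrite -oppr_eq0 qe.
have qpos' u : s < u -> u <= e -> 0 <= q u.
  move=> su; rewrite le_eqVlt => /predU1P[->|ue]; first by rewrite qe.
  have [ux|/ltW xu] := leP u x; first by rewrite ltW// qpos.
  by have := he _ xu ue; rewrite oppr_lt0 => /ltW.
have rneg y z : s < y -> y <= z -> z <= e -> z < 1 -> r y < 0 -> r z <= 0.
  move=> sy yz ze z1 ry.
  have y0 : 0 < y by exact: le_lt_trans sy.
  have y1 : y < 1 by exact: le_lt_trans z1.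
  have z0 : 0 < z by exact: lt_le_trans yz.
  have k_yz : k y <= k z by apply: beam_angle_mono; [rewrite (ltW y0) | exact: ltW].
  have p_yz : p y <= p z.
    apply: p_nondec_of; [by rewrite (ltW y0)|exact: ltW|].
    by move=> u _ /andP[yu uz]; apply: qpos'; [exact: lt_trans yu | exact: le_trans ze].
  have pz0 : 0 <= p y by apply: adjoint_ge0; rewrite !ltW.
  have /andP[ky0 _] : 0 <= k y < pi / 2 by apply: k_itv; rewrite (ltW y0).
  have /andP[_ kz1] : 0 <= k z < pi / 2 by apply: k_itv; rewrite (ltW z0).
  have pp := pi_gt0 R.
  have c_yz : cos (k z) <= cos (k y) by apply: le_cos => //; lra.
  have s_yz : sin (k y) <= sin (k z) by apply: le_sin => //; lra.
  have sy0 : 0 <= sin (k y) by apply: sin_angle_ge0; rewrite (ltW y0).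
  move: ry; rewrite er ?y0// /adjoint_load pmulr_rlt0 ?subr_gt0// => ry.
  rewrite er ?z0// /adjoint_load pmulr_rle0 ?subr_gt0//.
  have : sin (k y) * p y <= sin (k z) * p z by apply: ler_pM.
  by lra.
apply: q_noninc_of; [by rewrite (le_trans s0)|exact: le_trans x1|].
move=> y yI /andP[ty yt']; rewrite leNgt; apply/negP => ry.
have sy : s < y by exact: le_lt_trans ty.
have yx : y <= x by exact: le_trans t'x.
have : q y <= q e.
  apply: q_nondec_of => //; first by rewrite (le_trans s0 (ltW sy)) (le_trans yx (ltW xe)).
  move=> z /andP[_ z1] /andP[yz ze]; apply: (rneg y) => //; exact: ltW.
by rewrite qe leNgt qpos.
Qed.

(** It suffices that [q] is positive on all of [[0, x]]. Otherwise let [s] be its last zero before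
    [x]; [q_noninc_pos] asks for positivity only after [s], so it applies from [s] itself and gives
    [q x <= q s = 0]. *)
Lemma adjoint_moment_noninc x : 0 <= x <= 1 -> 0 < q x ->
  forall t, 0 <= t <= x -> q x <= q t.
Proof.
move=> /andP[x0 x1] qx.
have qpos y : 0 <= y -> y <= x -> 0 < q y.
  move=> y0 yx; rewrite ltNge; apply/negP => qy.
  have [|||s [ys sx qs hs]] := @last_nonneg _ (fun t => - q t) y x (lip01N q_lip) y0 yx.
  - by [].
  - by rewrite oppr_ge0.
  - by rewrite oppr_lt0.
  have : q x <= q s.
    apply: (q_noninc_pos (s := s) (x := x)) => //.
    + by rewrite (le_trans y0 ys) ltW.
    + by move=> t st tx; have := hs _ st tx; rewrite oppr_lt0.
    + exact: ltW.
  by move/eqP: qs; rewrite oppr_eq0 => /eqP ->; rewrite leNgt qx.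
move=> t /andP[t0 tx]; apply: (q_noninc_pos (s := 0) (x := x)) => //.
- by rewrite lexx.
- by move=> u u0 ux; apply: qpos => //; exact: ltW.
Qed.

Local Notation M := (tail (bending k)).

Lemma moment_decr s t : 0 <= s -> s < t -> t < 1 -> M t < M s.
Proof.
move=> s0 st t1; rewrite -subr_gt0.
have t0 := le_lt_trans s0 st.
have tI : 0 <= t < 1 by rewrite ltW.
(* Both factors of [bending k] are nonincreasing, so on []s, t]] the load is at least its positive
   value at [t]. *)
apply: (@lt_le_trans _ _ ((1 - t) * cos (k t) * (t - s))).
  by rewrite !mulr_gt0 ?subr_gt0 ?cos_angle_gt0.
apply: tail_decr_ge; [by apply: bm_itg; exact: bm_bending|by rewrite s0 ltW|exact: ltW|].
move=> x /andP[x0 x1] /andP[sx xt]; have pp := pi_gt0 R.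
have /andP[kx0 _] : 0 <= k x < pi / 2 by apply: k_itv; rewrite ltW.
have /andP[_ kt1] := k_itv tI.
apply: ler_pM.
- by rewrite subr_ge0 ltW.
- by rewrite ltW// cos_angle_gt0.
- by rewrite lerD2l lerN2.
- apply: le_cos => //; last by lra.
  by apply: beam_angle_mono; [rewrite (ltW x0) | exact: ltW].
Qed.

Lemma moment_bounds t : 0 <= t <= 1 -> 0 <= M t <= 1 - t.
Proof.
move=> /andP[t0 t1]; have t01 : 0 <= t <= 1 by rewrite t0.
have iB : itg (bending k) by apply: bm_itg; exact: bm_bending.
have -> : M t = M t - M 1 by rewrite tail1 subr0.
apply/andP; split.
  rewrite -[leLHS](mul0r (1 - t)); apply: tail_decr_ge => // x xI _.
  exact: bending_ge0.
rewrite -[leRHS]mul1r; apply: tail_decr_le => // x /andP[x0 x1] _.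
have c1 := cos_le1 (k x); have c0 : 0 < cos (k x) by rewrite cos_angle_gt0// ltW.
by rewrite /bending; nra.
Qed.

(** If [M q] reaches the level at [u], then [q u > 0] because [lam > 0] and [M >= 0]. At an earlier
    [t > 0] the factor [M] is strictly larger and [q] at least as large, so the level is strictly
    exceeded. *)
Lemma switching_point lam : 0 < lam -> exists s, [/\ 0 <= s < 1,
  forall t, 0 < t < s -> lam < M t * q t & forall t, s < t < 1 -> M t * q t < lam].
Proof.
move=> lam0.
have [Q Q0 qQ] : exists2 Q, 0 < Q & forall t, `|q t| <= Q.
  have [Q Q0 hQ] := bm_bound hr; exists Q => // t.
  by apply: norm_tail => //; exact: bm_itg.
(* Including 0 keeps [E] nonempty and yields [s = 0] if the level is never reached. The bound
   [M t <= 1 - t] keeps [E] away from 1. *)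
pose E := [set t | t = 0 \/ 0 <= t <= 1 /\ lam <= M t * q t].
have Eub t : E t -> t <= Num.max 0 (1 - lam / Q).
  case=> [->|[/andP[t0 t1] h]]; first by rewrite le_max lexx.
  rewrite le_max; apply/orP; right; rewrite lerBrDl -lerBrDr ler_pdivrMr//.
  apply: (le_trans h); have /andP[M0 M1] : 0 <= M t <= 1 - t by apply: moment_bounds; rewrite t0.
  apply: (@le_trans _ _ (M t * Q)); last by rewrite ler_wpM2r// ltW.
  by rewrite ler_wpM2l// (le_trans (ler_norm _)).
have hE : has_sup E.
  by split; [exists 0; left | exists (Num.max 0 (1 - lam / Q))].
have E0 : E 0 by left.
exists (sup E); split.
- apply/andP; split; first by apply: ub_le_sup => //; case: hE.
  have : sup E <= Num.max 0 (1 - lam / Q) by apply: ge_sup; [exists 0 | exact: Eub].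
  by move=> /le_lt_trans; apply; rewrite gt_max ltr01 gtrBl divr_gt0.
- move=> t /andP[t0 ts].
  have [|u Eu] := @sup_adherent _ E (sup E - t) _ hE; first by rewrite subr_gt0.
  have -> : sup E - (sup E - t) = t by ring.
  move=> tu; case: Eu => [u0|[/andP[u0 u1] h]].
    by move: (lt_trans t0 tu); rewrite u0 ltxx.
  have Mu0 : 0 <= M u by have /andP[] : 0 <= M u <= 1 - u by apply: moment_bounds; rewrite u0.
  have qu : 0 < q u.
    rewrite ltNge; apply/negP => qu; move: (lt_le_trans lam0 h).
    by rewrite ltNge mulr_ge0_le0.
  have u1' : u < 1.
    rewrite lt_neqAle u1 andbT; apply/eqP => u1E.
    by move: qu; rewrite u1E tail1 ltxx.
  apply: (le_lt_trans h); apply: (@lt_le_trans _ _ (M t * q u)).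
    by rewrite ltr_pM2r// moment_decr// ltW.
  have /andP[Mt0 _] : 0 <= M t <= 1 - t.
    by apply: moment_bounds; rewrite (ltW t0) (le_trans (ltW tu)).
  by rewrite ler_wpM2l// adjoint_moment_noninc ?u0// (ltW t0) ltW.
- move=> t /andP[st t1]; rewrite ltNge; apply/negP => h.
  move: (st); rewrite ltNge => /negP; apply; apply: ub_le_sup; first by case: hE.
  right; split=> //; rewrite (ltW t1) andbT.
  by apply: ltW; apply: le_lt_trans st; apply: ub_le_sup => //; case: hE.
Qed.

End adjoint_sign.
End adjoint.

Ltac bm_arith := apply: bm_itg; repeat first [assumption | apply: bmM | apply: bmB | apply: bmD].

(** * First-order expansion of the load *)

Section perturbation.
Context {R : realType}.
Implicit Types (t x : R).
Variables (beta k : R -> R) (b1 : R).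
Hypotheses (hb : bm beta) (b1_gt0 : 0 < b1).
Hypothesis beta01 : forall t, 0 < t < 1 -> 0 <= beta t <= b1.
Hypothesis hk : beam_angle beta k.
Variables (zeta : R -> R) (Z : R).
Hypotheses (hz : bm zeta) (Z_ge0 : 0 <= Z).
Hypothesis zetaZ : forall t, 0 < t < 1 -> `|zeta t| <= Z.

Lemma norm_bending (w : R -> R) x : 0 < x < 1 -> `|bending w x| <= 1.
Proof.
move=> /andP[x0 x1]; rewrite /bending normrM (ger0_norm (_ : 0 <= 1 - x)); last first.
  by rewrite subr_ge0 ltW.
by rewrite mulr_ile1 ?subr_ge0 ?(ltW x1)// ?cos_max// gerBl ltW.
Qed.

Section one_perturbation.
Variables (e : R) (k' : R -> R).
Hypothesis e_ge0 : 0 <= e.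
Hypothesis hk' : beam_angle (fun t => beta t + e * zeta t) k'.
Let sigma t := bending k' t - bending k t.

Let kbm : bm k. Proof. by case: hk. Qed.
Let k'bm : bm k'. Proof. by case: hk'. Qed.
Let sigma_bm : bm sigma.
Proof. by apply: bmB; exact: bm_bending. Qed.

Let M'bm : bm (tail (bending k')).
Proof. by apply: tail_bm; apply: bm_itg; exact: bm_bending. Qed.

Let Mbm : bm (tail (bending k)).
Proof. by apply: tail_bm; apply: bm_itg; exact: bm_bending. Qed.

Let zM'bm : bm (fun x => e * (zeta x * tail (bending k') x)).
Proof. by apply: bmZ; apply: bmM. Qed.

Let tail_sigma t : tail sigma t = tail (bending k') t - tail (bending k) t.
Proof. by apply: tailB; apply: bm_itg; exact: bm_bending. Qed.

(** The difference of the integrands is [e zeta M' + beta (M' - M)]. Keeping the perturbed moment in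
    the first term makes the identity exact. *)
Lemma angle_diff t : 0 <= t <= 1 -> k' t - k t =
  prim (fun x => e * (zeta x * tail (bending k') x)) t + green beta sigma t.
Proof.
move=> t01; have [_ ek _] := hk; have [_ ek' _] := hk'.
rewrite (ek _ t01) (ek' _ t01) greenB; [|by []|exact: bm_bending..].
rewrite addrA; congr (_ - _); rewrite /green -primD.
- by apply: (congr1 (@^~ t)); apply: eq_prim => x _; ring.
- exact: bm_itg.
- by apply: bm_itg; apply: bm_beta_tail => //; exact: bm_bending.
Qed.

(** Let [w] be the first term of [angle_diff]. The cosine being antitone and 1-Lipschitz on the
    range of the angles, [sigma (k' - k) <= - sigma^2], so [sigma * green beta sigma <= - sigma^2 -
    sigma w <= w^2 / 4]. This bounds [quad beta sigma], and [green_sqr_le] turns it into a pointwise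
    bound linear in [e]. *)
Lemma angle_stability t : 0 <= t <= 1 -> `|k' t - k t| <= e * (Z * (2 + b1)).
Proof.
have [w wE] : exists w, w = prim (fun x => e * (zeta x * tail (bending k') x)).
  by eexists.
have hw x : `|w x| <= e * Z.
  rewrite wE; apply: norm_prim; first exact: bm_itg.
  move=> y yI; rewrite !normrM (ger0_norm e_ge0) ler_wpM2l// -[leRHS]mulr1.
  apply: ler_pM => //; first exact: zetaZ.
  apply: norm_tail; first by apply: bm_itg; exact: bm_bending.
  by move=> z; exact: norm_bending.
have wbm : bm w by rewrite wE; apply: prim_bm; exact: bm_itg.
have hq : quad beta sigma <= (e * Z) ^+ 2 / 4.
  rewrite /quad -[leRHS]int01_cst; apply: le_int01; [|exact: itg_cst|].
    by apply: bm_itg; apply: bmM => //; exact: green_bm.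
  move=> x xI; have [x0 x1] := andP xI.
  have x01 : 0 <= x <= 1 by rewrite !ltW.
  have x01' : 0 <= x < 1 by rewrite ltW.
  have -> : green beta sigma x = k' x - k x - w x.
    by rewrite (angle_diff x01) wE; ring.
  have [_ _ /(_ _ x01') /andP[kx0 kx1]] := hk.
  have [_ _ /(_ _ x01') /andP[kx0' kx1']] := hk'.
  have pp := pi_gt0 R.
  have clip := cos_lipschitz (k x) (k' x).
  have anti : (cos (k' x) - cos (k x)) * (k' x - k x) <= 0.
    have [le|/ltW le] := leP (k' x) (k x).
      by apply: mulr_ge0_le0; rewrite ?subr_ge0 ?subr_le0//; apply: le_cos => //; lra.
    by apply: mulr_le0_ge0; rewrite ?subr_ge0 ?subr_le0//; apply: le_cos => //; lra.
  have sE : sigma x = (1 - x) * (cos (k' x) - cos (k x)).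
    by rewrite /sigma /bending; ring.
  have sd : sigma x * (k' x - k x) <= - sigma x ^+ 2.
    have h : (cos (k' x) - cos (k x)) ^+ 2 <= - ((cos (k' x) - cos (k x)) * (k' x - k x)).
      rewrite -(ler0_norm anti) normrM -[leLHS]real_normK ?num_real//.
      by rewrite expr2 ler_wpM2l.
    have h2 := sqr_ge0 (cos (k' x) - cos (k x)).
    rewrite sE; move: h h2 anti; set c := cos _ - cos _; set d := k' x - k x => h h2 anti.
    have -> : (1 - x) * c * d = (1 - x) * (c * d) by ring.
    have h3 : (1 - x) * (c * d) <= (1 - x) * (- c ^+ 2).
      by rewrite ler_wpM2l ?subr_ge0 ?(ltW x1)//; lra.
    apply: (le_trans h3).
    have -> : - ((1 - x) * c) ^+ 2 = (1 - x) * ((1 - x) * (- c ^+ 2)) by ring.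
    rewrite ler_wpM2l ?subr_ge0 ?(ltW x1)//.
    by rewrite mulrN lerN2 ler_piMl// gerBl ltW.
  have w2 : w x ^+ 2 <= (e * Z) ^+ 2.
    rewrite -real_normK ?num_real// lerXn2r ?nnegrE ?mulr_ge0//; exact: hw.
  have := sqr_ge0 (sigma x + w x / 2).
  have -> : (sigma x + w x / 2) ^+ 2 = sigma x ^+ 2 + sigma x * w x + w x ^+ 2 / 4 by field.
  by rewrite mulrBr; lra.
move=> t01; rewrite (angle_diff t01) -wE.
(* Here [(1 + b1) / 2] is a rational upper bound for half the square root of [b1]. *)
have hg : `|green beta sigma t| <= e * Z * ((1 + b1) / 2).
  have b10 := b1_gt0.
  have eZ0 : 0 <= e * Z by rewrite mulr_ge0.
  have c0 : 0 <= (1 + b1) / 2 by lra.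
  have eZc0 : 0 <= e * Z * ((1 + b1) / 2) by exact: mulr_ge0.
  rewrite -ler_sqr ?nnegrE// real_normK ?num_real//.
  apply: (le_trans (green_sqr_le hb b1_gt0 beta01 t sigma_bm)).
  apply: (le_trans (ler_wpM2l (ltW b1_gt0) hq)).
  have -> : b1 * ((e * Z) ^+ 2 / 4) = (e * Z) ^+ 2 * (b1 / 4) by ring.
  rewrite [leRHS]exprMn ler_wpM2l ?sqr_ge0//.
  have -> : ((1 + b1) / 2) ^+ 2 = b1 / 4 + (1 + b1 + b1 ^+ 2) / 4 by field.
  by rewrite lerDl divr_ge0// !addr_ge0// ?sqr_ge0// ltW.
apply: (le_trans (ler_normD _ _)).
have -> : e * (Z * (2 + b1)) = e * Z + e * Z * (1 + b1) by ring.
apply: lerD; first exact: hw.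
apply: (le_trans hg); rewrite ler_wpM2l ?mulr_ge0//.
by have b10 := b1_gt0; lra.
Qed.

Section expansion.
Variables (r : R -> R) (P Q : R).
Hypotheses (hr : bm r)
  (er : forall t, 0 < t < 1 -> r t = adjoint_load k (green beta r) t).
Hypothesis hP : forall t, 0 < t < 1 -> `|green beta r t| <= P.
Hypothesis hQ : forall t, `|tail r t| <= Q.
Local Notation p := (green beta r).
Local Notation q := (tail r).
Local Notation M := (tail (bending k)).
Local Notation M' := (tail (bending k')).
Let d t := k' t - k t.
Let S := Z * (2 + b1).

(* Testing the equation of the adjoint [green beta r] with [d] removes the
   linear terms in [d]. *)
Lemma load_expansion :
  int01 (fun t => (1 - t) * sin (k' t)) - int01 (fun t => (1 - t) * sin (k t)) -
    e * int01 (fun t => zeta t * (M t * q t)) =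
  int01 (fun t => (1 - t) * (sin (k' t) - sin (k t) - cos (k t) * d t)) +
  int01 (fun t => (1 - t) * (cos (k' t) - cos (k t) + sin (k t) * d t) * p t) +
  e * int01 (fun t => zeta t * (tail sigma t * q t)).
Proof.
have fbm := @bm_load R.
have dbm : bm d by exact: bmB.
have pbm : bm p by exact: green_bm.
have qbm : bm q by apply: tail_bm; exact: bm_itg.
have sk := bm_sin kbm; have ck := bm_cos kbm.
have sk' := bm_sin k'bm; have ck' := bm_cos k'bm.
(* The coupling term [p sin k] of the adjoint equation tested with [d]; it enters through [i2] and
   [i4] and cancels. *)
pose u5 t := (1 - t) * sin (k t) * (p t * d t).
have u5bm : bm u5 by apply: bmM; apply: bmM.
have i1 : int01 (fun t => (1 - t) * (sin (k' t) - sin (k t) - cos (k t) * d t)) =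
    int01 (fun t => (1 - t) * sin (k' t)) - int01 (fun t => (1 - t) * sin (k t)) -
    int01 (fun t => (1 - t) * (cos (k t) * d t)).
  rewrite -!int01B; first by apply: eq_int01 => t _; ring.
  1-4: bm_arith.
have i2 : int01 (fun t => (1 - t) * (cos (k t) * d t)) =
    int01 (fun t => r t * d t) + int01 u5.
  rewrite -int01D; [|by apply: bm_itg; exact: bmM|exact: bm_itg].
  by apply: eq_int01 => t tI; rewrite er// /adjoint_load /u5; ring.
(* The two terms of [angle_diff] are paired with [r]: the first is handled by [exchange], the second
   by the symmetry of the Green operator. *)
have i3 : int01 (fun t => r t * d t) =
    e * int01 (fun t => zeta t * (M' t * q t)) + int01 (fun t => sigma t * p t).
  have wbm := prim_bm (bm_itg zM'bm).
  have gbm := green_bm hb sigma_bm.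
  have e1 : int01 (fun t => r t * d t) =
      int01 (fun t => r t * prim (fun x => e * (zeta x * M' x)) t) +
      int01 (fun t => r t * green beta sigma t).
    rewrite -(int01D (bm_itg (bmM hr wbm)) (bm_itg (bmM hr gbm))).
    apply: eq_int01 => t /andP[t0 t1]; rewrite -mulrDr; congr (_ * _).
    by apply: angle_diff; rewrite !ltW.
  have e2 := exchange (bm_itg hr) (bm_itg zM'bm).
  have e3 := int01Z e (bm_itg (bmM hz (bmM M'bm qbm))).
  have e4 := int01_greenC hb sigma_bm hr.
  rewrite e1 e2 -e3 e4; apply: (congr1 (+%R^~ _)).
  by apply: eq_int01 => t _; ring.
have i4 : int01 (fun t => (1 - t) * (cos (k' t) - cos (k t) + sin (k t) * d t) * p t) =
    int01 (fun t => sigma t * p t) + int01 u5.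
  rewrite -int01D; [|by apply: bm_itg; exact: bmM|exact: bm_itg].
  by apply: eq_int01 => t _; rewrite /sigma /u5 /bending; ring.
have i5 : int01 (fun t => zeta t * (tail sigma t * q t)) =
    int01 (fun t => zeta t * (M' t * q t)) - int01 (fun t => zeta t * (M t * q t)).
  rewrite -(int01B (bm_itg (bmM hz (bmM M'bm qbm))) (bm_itg (bmM hz (bmM Mbm qbm)))).
  by apply: eq_int01 => t _; rewrite tail_sigma; ring.
rewrite i1 i2 i3 i4 i5; ring.
Qed.

(** By [angle_stability] the difference [d] is of order [e]. It enters squared in the two Taylor
    remainders and linearly in [tail sigma], which carries another factor [e]. *)
Lemma load_derivative :
  `|int01 (fun t => (1 - t) * sin (k' t)) - int01 (fun t => (1 - t) * sin (k t)) -
    e * int01 (fun t => zeta t * (M t * q t))| <=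
  e ^+ 2 * (S ^+ 2 + S ^+ 2 * P + Z * S * Q).
Proof.
have b10 := b1_gt0; have Z0 := Z_ge0.
have S0 : 0 <= S by rewrite mulr_ge0// addr_ge0// ltW.
have eS0 : 0 <= e * S by rewrite mulr_ge0.
have fbm := @bm_load R.
have dbm : bm d by exact: bmB.
have pbm : bm p by exact: green_bm.
have qbm : bm q by apply: tail_bm; exact: bm_itg.
have sk := bm_sin kbm; have ck := bm_cos kbm.
have sk' := bm_sin k'bm; have ck' := bm_cos k'bm.
have dS t : 0 < t < 1 -> `|d t| <= e * S.
  by move=> /andP[t0 t1]; apply: angle_stability; rewrite !ltW.
have d2 t : 0 < t < 1 -> d t ^+ 2 <= (e * S) ^+ 2.
  by move=> tI; rewrite -real_normK ?num_real// lerXn2r ?nnegrE// dS.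
have f01 t : 0 < t < 1 -> `|1 - t| <= 1.
  by move=> /andP[t0 t1]; rewrite ger0_norm ?subr_ge0 ?ltW// gtrBl.
rewrite load_expansion.
have -> : e ^+ 2 * (S ^+ 2 + S ^+ 2 * P + Z * S * Q) =
  (e * S) ^+ 2 + (e * S) ^+ 2 * P + e * (Z * (e * S * Q)) by ring.
apply: (le_trans (ler_normD _ _)); apply: lerD.
  apply: (le_trans (ler_normD _ _)); apply: lerD.
    apply: norm_int01.
      apply: bm_itg; apply: bmM => //; apply: bmB; first exact: bmB.
      exact: bmM.
    move=> t tI; rewrite normrM; apply: le_trans (d2 _ tI).
    by apply: le_trans (sin_taylor _ _); rewrite ler_piMl// f01.
  apply: norm_int01.
    apply: bm_itg; apply: bmM => //; apply: bmM => //; apply: bmD; first exact: bmB.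
    exact: bmM.
  move=> t tI; rewrite normrM; apply: ler_pM; [by []|by []| |exact: hP].
  rewrite normrM; apply: le_trans (d2 _ tI).
  by apply: le_trans (cos_taylor _ _); rewrite ler_piMl// f01.
rewrite normrM (ger0_norm e_ge0) ler_wpM2l//; apply: norm_int01.
  by apply: bm_itg; apply: bmM => //; apply: bmM => //; apply: tail_bm; exact: bm_itg.
move=> t tI; rewrite normrM; apply: ler_pM; [by []|by []|exact: zetaZ|].
rewrite normrM; apply: ler_pM; [by []|by []| |exact: hQ].
apply: norm_tail; first exact: bm_itg.
move=> x xI; apply: le_trans (dS x xI).
have -> : sigma x = (1 - x) * (cos (k' x) - cos (k x)) by rewrite /sigma /bending; ring.
by rewrite normrM (le_trans _ (cos_lipschitz _ _))// ler_piMl// f01.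
Qed.

End expansion.
End one_perturbation.
End perturbation.

(** * Weak derivatives *)

Section lebesgue_spaces.
Context {R : realType}.
Notation mu := (@lebesgue_measure R).
Notation I := (@unit_itv R).
Implicit Types (u v w phi : R -> R) (s t x y : R).
Hint Resolve measurable_I : core.

Lemma measurable_restrict_I u : measurable_fun I u -> measurable_fun setT (u \_ I).
Proof. by move=> mu1; apply/(measurable_restrictT _ measurable_I). Qed.

Lemma bm_memLp2 u : bm u -> memLp 2%:E u.
Proof.
move=> hu; rewrite /memLp inE; apply/andP; split; rewrite inE/=.
  by apply: measurable_restrict_I; case: hu.
rewrite /finite_norm unlock poweR_lty//.
have /integrableP[_] := bm_itg (bmM hu hu).
apply: le_lt_trans; rewrite [leRHS]integral_mkcond le_eqVlt; apply/orP; left.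
apply/eqP; apply: eq_integral => x _ /=; rewrite !patchE.
case: ifP => _; rewrite powR_mulrn// -normrX.
  by rewrite expr2.
by rewrite expr0n normr0.
Qed.

(** Hölder's inequality with the constant 1 as second factor. *)
Lemma memLp2_itg u : memLp 2%:E u -> itg u.
Proof.
move=> hu; have h1 := Lfun2_mul_Lfun1 hu (bm_memLp2 (bm_cst (1 : R))).
have /Lfun1_integrable/integrableP[mf hf] := h1.
have uE : (u \_ I) \* ((fun _ : R => 1 : R) \_ I) = u \_ I.
  by apply/funext => x; rewrite /= !patchE; case: ifP => _; rewrite ?mulr1 ?mulr0.
rewrite uE in mf hf.
apply/integrableP; split.
  apply/measurable_EFinP/(measurable_restrictT _ measurable_I).
  exact/measurable_EFinP.
move: hf; apply: le_lt_trans; rewrite [leLHS]integral_mkcond le_eqVlt.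
apply/orP; left; apply/eqP; apply: eq_integral => x _ /=; rewrite !patchE.
by case: ifP => _ //; rewrite normr0.
Qed.

Lemma ess_sup_restrict_le u C : 0 <= C -> (forall t, 0 < t < 1 -> `|u t| <= C) ->
  ('N[mu]_+oo[EFin \o (u \_ I)] <= C%:E)%E.
Proof.
move=> C0 uC; rewrite unlock; case: ifP => _; last by rewrite lee_fin.
apply/ess_supP; apply: nearW => x /=; rewrite lee_fin patchE.
case: ifPn => [|_]; last by rewrite normr0.
by rewrite inE unit_itvE; exact: uC.
Qed.

Lemma bm_memLpoo u : bm u -> memLp +oo%E u.
Proof.
move=> hu; rewrite /memLp inE; apply/andP; split; rewrite inE/=.
  by apply: measurable_restrict_I; case: hu.
have [C C0 uC] := bm_bound hu.
by rewrite /finite_norm; apply: le_lt_trans (ess_sup_restrict_le (ltW C0) uC) _; rewrite ltry.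
Qed.

Lemma memLpoo_measurable u : memLp +oo%E u -> measurable_fun I u.
Proof.
move=> /sub_Lfun_mfun; rewrite inE/= => h.
exact/(measurable_restrictT _ measurable_I).
Qed.

Lemma Linfty_norm_le u C : 0 <= C -> (forall t, 0 < t < 1 -> `|u t| <= C) ->
  Linfty_norm u <= C.
Proof.
move=> C0 uC; rewrite /Linfty_norm; have := ess_sup_restrict_le C0 uC.
have := Lnorm_ge0 mu +oo%E (EFin \o (u \_ I)).
by case: (Lnorm _ _ _).
Qed.

Lemma ae_eq0_int01_norm u : itg u -> int01 (fun t => `|u t|) = 0 ->
  ae_unit_itv (fun t => u t = 0).
Proof.
move=> iu h; have mu1 : measurable_fun I (EFin \o u).
  by apply/measurable_EFinP; exact: itg_measurable.
have /(ae_eq_integral_abs mu measurable_I mu1) : (\int[mu]_(x in I) `|(EFin \o u) x| = 0)%E.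
  by rewrite (integral_int01 (itg_norm iu)) h.
by apply: (@filterS _ _ (ae_filter_ringOfSetsType mu)) => t h1 /h1 [].
Qed.

End lebesgue_spaces.

(** * Test functions and classical primitives *)

Section weak_derivatives.
Context {R : realType}.
Notation mu := (@lebesgue_measure R).
Notation I := (@unit_itv R).
Implicit Types (u v w phi : R -> R) (s t x y : R).
Hint Resolve measurable_I : core.

Lemma bm_within_continuous w : {within `[0, 1], continuous w} -> bm w.
Proof.
move=> cw; split.
  apply: subspace_continuous_measurable_fun; first exact: measurable_itv.
  by apply: (continuous_subspaceW _ cw); exact: subset_itv_oo_cc.
have cp : compact (w @` `[0, 1]) by apply: continuous_compact => //; exact: segment_compact.
have [M [_ hM]] := compact_bounded cp.
exists (M + 1) => t; rewrite unit_itvE => /andP[t0 t1].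
apply: (hM (M + 1)); first by rewrite ltrDl.
by exists t => //; rewrite /= in_itv/= !ltW.
Qed.

Lemma prim_derivable v : itg v -> continuous (v \_ I) ->
  forall t, derivable (prim v) t 1 /\ derive1 (prim v) t = (v \_ I) t.
Proof.
move=> iv cv t.
have -> : prim v = fun t => \int[mu]_(x in `]-oo, t]) (v \_ I) x.
  by apply/funext => x; rewrite prim_RintegralNy.
apply: (@continuous_FTC1 R (v \_ I) -oo%O t (t + 1)).
- by rewrite ltrDl.
- exact: integrable_restrict_I.
- by rewrite ltNyr.
- exact: cv.
Qed.

Lemma test_function_bm phi : test_function phi -> bm phi /\ bm (derive1 phi).
Proof.
move=> [dphi cphi _ _]; split; apply: bm_within_continuous; apply: continuous_subspaceT => //.
move=> x; apply: differentiable_continuous; exact/derivable1_diffP.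
Qed.

Lemma test_function_out phi t : test_function phi -> ~ (0 < t < 1) -> phi t = 0.
Proof.
move=> [_ _ _ sub] t01; apply: contrapT => /eqP pt; apply: t01.
by rewrite -unit_itvE; apply: sub; apply: subset_closure.
Qed.

Lemma tail_test_function phi s : test_function phi -> 0 < s < 1 ->
  tail (derive1 phi) s = - phi s.
Proof.
move=> tphi s01; have [s0 s1] := andP s01.
have [bphi bdphi] := test_function_bm tphi.
have phi0 : phi 0 = 0 by apply: test_function_out => //; rewrite ltxx.
have phi1 : phi 1 = 0 by apply: test_function_out => //; rewrite ltxx andbF.
have key t : 0 < t <= 1 -> prim (derive1 phi) t = phi t.
  move=> /andP[t0 t1]; have [dphi cphi _ _] := tphi.
  have cf : continuous phi.
    by move=> x; apply: differentiable_continuous; exact/derivable1_diffP.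
  have dl : derivable_oo_LRcontinuous phi 0 t.
    split; first by move=> x _; exact: dphi.
      by apply: cvg_at_right_filter; exact: cf.
    by apply: cvg_at_left_filter; exact: cf.
  have cd : {within `[0, t], continuous (derive1 phi)} by exact: continuous_subspaceT.
  have H := continuous_FTC2 t0 cd dl (fun x _ => erefl).
  rewrite phi0 sube0 in H.
  have -> : phi t = \int[mu]_(x in `[0, t]) (derive1 phi) x by rewrite /Rintegral H.
  apply: prim_Rintegral_itv => //; first exact: bm_itg.
  by apply: measurable_funTS; exact: continuous_measurable_fun.
rewrite tail_prim; last exact: bm_itg.
by rewrite -(prim1 (derive1 phi) (lexx 1)) !key ?ltr01 ?lexx ?phi1 ?sub0r// s0 ltW.
Qed.

End weak_derivatives.

(** * The du Bois-Reymond lemma and the space [X] *)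

Section du_bois_reymond.
Context {R : realType}.
Notation mu := (@lebesgue_measure R).
Notation I := (@unit_itv R).
Implicit Types (u v w phi psi K G : R -> R) (s t x y : R).

Lemma prim_weak_derivative G : memLp 2%:E G -> is_weak_derivative (prim G) G.
Proof.
move=> hG; split => // phi tphi; have iG := memLp2_itg hG.
have [bphi bdphi] := test_function_bm tphi.
transitivity (int01 (fun t => derive1 phi t * prim G t)).
  by apply: eq_int01 => t _; rewrite mulrC.
rewrite (exchange (bm_itg bdphi) iG) -(int01N (itgM iG bphi)).
by apply: eq_int01 => t tI; rewrite tail_test_function// mulrN.
Qed.

(** The zero mean is what makes the primitive vanish to the right of the support of [psi] as
    well. *)
Lemma prim_test_function psi l h : continuous psi -> 0 < l -> h < 1 ->
  (forall s, ~ (l <= s <= h) -> psi s = 0) -> int01 psi = 0 ->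
  test_function (prim psi) /\ derive1 (prim psi) = psi.
Proof.
move=> cpsi l0 h1 supp ipsi.
have bpsi : bm psi by apply: bm_within_continuous; exact: continuous_subspaceT.
have psiI : psi \_ I = psi.
  apply/funext => s; rewrite patchE; case: ifPn => //.
  rewrite notin_setE unit_itvE => sI; rewrite supp// => /andP[ls sh].
  by apply: sI; rewrite (lt_le_trans l0 ls) (le_lt_trans sh h1).
have cI : continuous (psi \_ I) by rewrite psiI.
have D := prim_derivable (bm_itg bpsi) cI.
have dE : derive1 (prim psi) = psi by apply/funext => t; rewrite (D t).2 psiI.
have sub : closure [set x | prim psi x != 0] `<=` `[l, h].
  have -> : `[l, h]%classic = closure `[l, h] by apply/closure_id; exact: interval_closed.
  apply: closure_subset => t /= pt; rewrite in_itv/=.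
  apply/andP; split; rewrite leNgt; apply/negP => lt.
    move/negP: pt; apply; apply/eqP; rewrite -(int01_cst 0).
    apply: eq_int01 => s _; rewrite /step; have [st|st] := leP s t; last by rewrite mulr0.
    by rewrite supp ?mul0r// => /andP[]; rewrite leNgt (le_lt_trans st lt).
  move/negP: pt; apply; apply/eqP; rewrite -ipsi.
  apply: eq_int01 => s _; rewrite /step; have [st|st] := leP s t; first by rewrite mulr1.
  by rewrite mulr0 supp// => /andP[_]; rewrite leNgt (lt_trans lt st).
split => //; split.
- by move=> x; exact: (D x).1.
- by rewrite dE.
- apply: (subclosed_compact _ (@segment_compact _ l h)) => //; exact: closed_closure.
- apply: (subset_trans sub) => t /=; rewrite in_itv/= => /andP[lt th].
  by rewrite unit_itvE (lt_le_trans l0 lt) (le_lt_trans th h1).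
Qed.

(** A continuous bump is regular enough here, because test functions are only required to be C^1. *)
Definition tent x d s : R := Num.max 0 (d - `|s - x|).

Lemma tent_continuous x d : continuous (tent x d).
Proof.
move=> s; apply: (@continuous_max R R (fun=> 0) (fun s => d - `|s - x|) s).
  exact: cst_continuous.
apply: cvgB; first exact: cvg_cst.
by apply: cvg_norm; apply: cvgB; [exact: cvg_id | exact: cvg_cst].
Qed.

Lemma tent_out x d s : d <= `|s - x| -> tent x d s = 0.
Proof. by move=> h; rewrite /tent (max_idPl _)// subr_le0. Qed.

Lemma tent_ge0 x d s : 0 <= tent x d s.
Proof. by rewrite /tent le_max lexx. Qed.

Lemma tent_bm x d : bm (tent x d).
Proof.
apply: bm_within_continuous; apply: continuous_subspaceT; exact: tent_continuous.
Qed.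

Lemma tent_int01_gt0 x d : 0 < d -> 0 < x - d -> x + d < 1 -> 0 < int01 (tent x d).
Proof.
move=> d0 xd0 xd1; have it := bm_itg (tent_bm x d).
have h : d / 2 * (x + d / 2 - (x - d / 2)) <=
    prim (tent x d) (x + d / 2) - prim (tent x d) (x - d / 2).
  apply: prim_incr_ge => //; [by lra|by lra|].
  move=> s _ /andP[s1 s2]; rewrite /tent le_max; apply/orP; right.
  have : `|s - x| <= d / 2 by rewrite ler_norml; lra.
  by lra.
have p0 : 0 <= prim (tent x d) (x - d / 2).
  by apply: int01_ge0 => s _; rewrite mulr_ge0 ?tent_ge0// /step; case: (s <= _).
have p1 : prim (tent x d) (x + d / 2) <= int01 (tent x d).
  apply: le_int01 => //; first exact: itg_prim.
  by move=> s _; rewrite ler_piMr ?tent_ge0// /step; case: (s <= _).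
have : 0 < d / 2 * (x + d / 2 - (x - d / 2)) by rewrite mulr_gt0; lra.
by lra.
Qed.

(** The du Bois-Reymond lemma, stated as an inequality that yields equality on exchanging [x] and
    [y]. If [w x > w y], the orthogonality fails for the primitive of a difference of bumps at [x]
    and [y], weighted to have equal mass. *)
Lemma weakly_constant_le w : {within `[0, 1], continuous w} ->
  (forall phi, test_function phi -> int01 (fun t => w t * derive1 phi t) = 0) ->
  forall x y, 0 < x < 1 -> 0 < y < 1 -> w x <= w y.
Proof.
move=> cw orth x y xI yI; rewrite leNgt; apply/negP => wxy.
have bw := bm_within_continuous cw.
(* A third of the gap leaves [w x - e > w y + e], which separates the two weighted averages. *)
pose e := (w x - w y) / 3.
have e0 : 0 < e by rewrite divr_gt0// subr_gt0.
have loc z : 0 < z < 1 -> exists2 d, 0 < d & forall s, `|s - z| < d -> `|w s - w z| < e.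
  move=> zI; have /(continuous_within_itvP _ ltr01)[cin _ _] := cw.
  have cz : w s @[s --> z] --> w z by apply: cin; rewrite in_itv.
  have /nbhs_ballP[d d0 hd] : \forall s \near z, `|w z - w s| < e.
    by move/cvgrPdist_lt : cz; apply.
  by exists d => // s sz; rewrite distrC; apply: hd; rewrite /ball/= distrC.
have [dx dx0 hx] := loc x xI; have [dy dy0 hy] := loc y yI.
have [x0 x1] := andP xI; have [y0 y1] := andP yI.
have [d [d0 ddx ddy dd]] : exists d, [/\ 0 < d, d <= dx, d <= dy &
    [/\ 0 < x - d, x + d < 1, 0 < y - d & y + d < 1]].
  pose m := Num.min (Num.min dx dy) (Num.min (Num.min x (1 - x)) (Num.min y (1 - y))).
  have m0 : 0 < m by rewrite !lt_min dx0 dy0 x0 y0 !subr_gt0 x1 y1.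
  have : m <= m by [].
  rewrite {2}/m !le_min => /andP[/andP[m1 m2] /andP[/andP[m3 m4] /andP[m5 m6]]].
  by exists (m / 2); split; [lra|lra|lra|split; lra].
have [xd0 xd1 yd0 yd1] := dd.
have [bx bxE] : exists f, f = tent x d by eexists.
have [by' byE] : exists f, f = tent y d by eexists.
have bbx : bm bx by rewrite bxE; exact: tent_bm.
have bby : bm by' by rewrite byE; exact: tent_bm.
have cx0 : 0 < int01 bx by rewrite bxE; exact: tent_int01_gt0.
have cy0 : 0 < int01 by' by rewrite byE; exact: tent_int01_gt0.
set cx := int01 bx in cx0; set cy := int01 by' in cy0.
(* [psi] has mean zero, so its primitive is a test function. *)
pose psi s := cy * bx s - cx * by' s.
have ipsi : int01 psi = 0.
  rewrite (int01B (itgZ cy (bm_itg bbx)) (itgZ cx (bm_itg bby))).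
  rewrite (int01Z _ (bm_itg bbx)) (int01Z _ (bm_itg bby)) -/cx -/cy; ring.
have cpsi : continuous psi.
  move=> s; apply: cvgB; apply: cvgM; try exact: cvg_cst.
    by rewrite bxE; exact: tent_continuous.
  by rewrite byE; exact: tent_continuous.
have l0 : 0 < Num.min (x - d) (y - d) by rewrite lt_min xd0.
have h1 : Num.max (x + d) (y + d) < 1 by rewrite gt_max xd1.
have supp s : ~ (Num.min (x - d) (y - d) <= s <= Num.max (x + d) (y + d)) -> psi s = 0.
  move=> sout; rewrite /psi bxE byE.
  have out z : Num.min (x - d) (y - d) <= z - d -> z + d <= Num.max (x + d) (y + d) ->
      tent z d s = 0.
    move=> h2 h3; apply: tent_out; rewrite leNgt; apply/negP.
    rewrite ltr_norml => /andP[h4 h5]; apply: sout; lra.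
  rewrite !out ?mulr0 ?subr0// ?ge_min ?le_max ?lexx ?orbT//.
have [tpsi dpsi] := prim_test_function cpsi l0 h1 supp ipsi.
have := orth _ tpsi; rewrite dpsi.
have wbx := bm_itg (bmM bw bbx); have wby := bm_itg (bmM bw bby).
have -> : int01 (fun t => w t * psi t) =
    cy * int01 (fun t => w t * bx t) - cx * int01 (fun t => w t * by' t).
  rewrite -(int01Z _ wbx) -(int01Z _ wby) -(int01B (itgZ _ wbx) (itgZ _ wby)).
  by apply: eq_int01 => t _; rewrite /psi; ring.
have hX : (w x - e) * cx <= int01 (fun t => w t * bx t).
  rewrite -(int01Z _ (bm_itg bbx)); apply: le_int01 => //.
    exact: itgZ (bm_itg bbx).
  move=> t _; have [td|td] := ltP `|t - x| d.
    have := hx t (lt_le_trans td ddx); rewrite ltr_norml => /andP[h2 _].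
    by rewrite ler_wpM2r ?bxE ?tent_ge0//; lra.
  by rewrite bxE tent_out ?mulr0.
have hY : int01 (fun t => w t * by' t) <= (w y + e) * cy.
  rewrite -(int01Z _ (bm_itg bby)); apply: le_int01 => //.
    exact: itgZ (bm_itg bby).
  move=> t _; have [td|td] := ltP `|t - y| d.
    have := hy t (lt_le_trans td ddy); rewrite ltr_norml => /andP[_ h2].
    by rewrite ler_wpM2r ?byE ?tent_ge0//; lra.
  by rewrite byE tent_out ?mulr0.
have h2 : cy * ((w x - e) * cx) <= cy * int01 (fun t => w t * bx t).
  by rewrite ler_wpM2l// ltW.
have h3 : cx * int01 (fun t => w t * by' t) <= cx * ((w y + e) * cy).
  by rewrite ler_wpM2l// ltW.
have h4 : 0 < cy * ((w x - e) * cx) - cx * ((w y + e) * cy).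
  have -> : cy * ((w x - e) * cx) - cx * ((w y + e) * cy) =
    cx * cy * (w x - w y - 2 * e) by ring.
  by rewrite !mulr_gt0// /e; lra.
by lra.
Qed.

(** The difference [K - prim G] has zero weak derivative, so it is constant inside the interval, and
    continuity carries the constant to both endpoints. *)
Lemma weak_derivative_prim K G : {within `[0, 1], continuous K} ->
  is_weak_derivative K G -> forall t, 0 <= t <= 1 -> K t = K 0 + prim G t.
Proof.
have [c h2] : exists c : R, 0 < c < 1 by exists (1 / 2); lra.
move=> cK [hG wK]; have iG := memLp2_itg hG; have cG := prim_continuous iG.
have [w wE] : exists w, w = fun t => K t - prim G t by eexists.
have cw : {within `[0, 1], continuous w}.
  by rewrite wE => x; apply: cvgB; [exact: cK | exact: cG].
have orth phi : test_function phi -> int01 (fun t => w t * derive1 phi t) = 0.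
  move=> tphi; have [_ bdphi] := test_function_bm tphi.
  have [_ wG] := prim_weak_derivative hG.
  have iK := bm_itg (bmM (bm_within_continuous cK) bdphi).
  have iP := bm_itg (bmM (prim_bm iG) bdphi).
  transitivity (int01 (fun t => K t * derive1 phi t) -
                int01 (fun t => prim G t * derive1 phi t)).
    by rewrite -(int01B iK iP); apply: eq_int01 => t _; rewrite wE mulrBl.
  by rewrite wK// wG// subrr.
have wle := weakly_constant_le cw orth.
have cst t : 0 < t < 1 -> w t = w c.
  by move=> tI; apply/eqP; rewrite eq_le !wle.
have /(continuous_within_itvP _ ltr01)[_ c0 c1] := cw.
have w0 : w 0 = w c.
  have h : w t @[t --> 0^'+] --> w c.
    apply: cvg_near_cst; near=> t; apply: cst; apply/andP; split.
      by near: t; exact: nbhs_right_gt.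
    by near: t; exact: nbhs_right_lt.
  exact: (cvg_unique _ c0 h).
have w1 : w 1 = w c.
  have h : w t @[t --> 1^'-] --> w c.
    apply: cvg_near_cst; near=> t; apply: cst; apply/andP; split.
      by near: t; exact: nbhs_left_gt.
    by near: t; exact: nbhs_left_lt.
  exact: (cvg_unique _ c1 h).
have wt t : 0 <= t <= 1 -> w t = w c.
  move=> /andP[]; rewrite le_eqVlt => /predU1P[<-//|t0].
  by rewrite le_eqVlt => /predU1P[->//|t1]; apply: cst; rewrite t0.
move=> t tI; have := wt t tI; rewrite -w0 wE /= (prim0 G (lexx 0)) subr0 => <-.
by rewrite subrK.
Unshelve. all: by end_near. Qed.

Lemma weak_derivP K : sobolev12 K -> is_weak_derivative K (weak_deriv K).
Proof.
by move=> [_ _ exG]; exact: (@xgetPex _ (fun=> 0) [set G | is_weak_derivative K G]).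
Qed.

Lemma spaceX_prim K : spaceX K -> itg (weak_deriv K) /\
  forall t, 0 <= t <= 1 -> K t = prim (weak_deriv K) t.
Proof.
move=> [sK K0]; have wK := weak_derivP sK; have [cK _ _] := sK.
split; first by apply: memLp2_itg; case: wK.
by move=> t tI; rewrite (weak_derivative_prim cK wK tI) K0 add0r.
Qed.

Lemma prim_spaceX G : bm G -> spaceX (prim G).
Proof.
move=> bG; have iG := bm_itg bG; split; last by rewrite prim0.
split; first exact: prim_continuous.
  by apply: bm_memLp2; exact: prim_bm.
by exists G; apply: prim_weak_derivative; exact: bm_memLp2.
Qed.

Lemma weak_deriv_ae K G : spaceX K -> itg G ->
  (forall t, 0 <= t <= 1 -> K t = prim G t) ->
  ae_unit_itv (fun t => weak_deriv K t = G t).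
Proof.
move=> sK iG KG; have [iW KW] := spaceX_prim sK.
have z t : 0 <= t <= 1 -> prim (fun t => weak_deriv K t - G t) t = 0.
  by move=> tI; rewrite primB// -KW// -KG// subrr.
apply: ae_unit_itv_filter (prim_eq0 (itgB iW iG) z) => t _ /eqP.
by rewrite subr_eq0 => /eqP.
Qed.

End du_bois_reymond.

(** * The phase of a design *)

Section state_equation.
Context {R : realType}.
Notation mu := (@lebesgue_measure R).
Notation I := (@unit_itv R).
Implicit Types (s t x y : R).

(** By the convention [0^-1 = 0] the inverse is a continuous function on an open set, extended by
    0. *)
Lemma measurable_invr : measurable_fun setT (fun x : R => x^-1).
Proof.
have -> : (fun x : R => x^-1) = fun x => if x != 0 then x^-1 else 0.
  by apply/funext => x; case: eqVneq => [->|//]; rewrite invr0.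
have o0 : open [set x : R | x != 0] by exact: open_neq.
apply: measurable_fun_if => //.
- apply: (measurable_fun_bool true) => //; rewrite setTI.
  have -> : (fun x : R => x != 0) @^-1` [set true] = [set x | x != 0].
    by apply/seteqP; split.
  exact: open_measurable.
- have -> : setT `&` (fun x : R => x != 0) @^-1` [set true] = [set x | x != 0].
    by apply/seteqP; split => x //= [].
  apply: open_continuous_measurable_fun => // x; rewrite inE => x0.
  exact: inv_continuous.
Qed.

Variables (a b : R).
Hypotheses (a_gt0 : 0 < a) (ab : a < b).

Definition softness (x : R) := (1 - x) / a + x / b.

Lemma stiffnessE x : stiffness a b x = (softness x)^-1.
Proof. by []. Qed.

Lemma softness_bounds x : 0 <= x <= 1 -> b^-1 <= softness x <= a^-1.
Proof.
move=> /andP[x0 x1].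
have ba : b^-1 <= a^-1 by rewrite lef_pV2 ?posrE ?(ltW ab)// (lt_trans a_gt0).
rewrite /softness; apply/andP; split.
  have -> : (1 - x) / a + x / b = b^-1 + (1 - x) * (a^-1 - b^-1) by ring.
  by rewrite lerDl mulr_ge0 ?subr_ge0.
have -> : (1 - x) / a + x / b = a^-1 - x * (a^-1 - b^-1) by ring.
by rewrite gerBl mulr_ge0 ?subr_ge0.
Qed.

Lemma measurable_softness (u : R -> R) : measurable_fun I u ->
  measurable_fun I (fun t => softness (u t)).
Proof.
move=> mu1; apply: measurable_funD.
  by apply: measurable_funM => //; exact: measurable_funB.
by apply: measurable_funM.
Qed.

(** A design obeys its bounds only almost everywhere. Pointwise estimates use the representative
    [thc], while [phase] and [state_equation] keep referring to [theta]. *)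
Variables (theta thc : R -> R).
Hypotheses (mth : measurable_fun I theta) (bth : bm thc).
Hypothesis thc01 : forall t, 0 < t < 1 -> 0 <= thc t <= 1.
Hypothesis thE : ae_unit_itv (fun t => theta t = thc t).
Local Notation beta := (fun t => softness (thc t)).

Lemma softness_bm : bm beta.
Proof.
split; first by apply: measurable_softness; case: bth.
exists a^-1 => t; rewrite unit_itvE => tI; have /andP[h1 h2] := softness_bounds (thc01 tI).
by rewrite ger0_norm// (le_trans _ h1)// invr_ge0 ltW// (lt_trans a_gt0).
Qed.

Lemma softness_itv t : 0 < t < 1 -> 0 <= beta t <= a^-1.
Proof.
move=> tI; have /andP[h1 h2] := softness_bounds (thc01 tI).
by rewrite h2 (le_trans _ h1)// invr_ge0 ltW// (lt_trans a_gt0).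
Qed.

Lemma softness_gt0 t : 0 < t < 1 -> 0 < beta t.
Proof.
move=> tI; have /andP[h1 h2] := softness_bounds (thc01 tI).
by rewrite (lt_le_trans _ h1)// invr_gt0 (lt_trans a_gt0).
Qed.

Lemma stiffness_bm : bm (fun t => (beta t)^-1).
Proof.
split.
  by apply: (measurableT_comp measurable_invr); case: softness_bm.
exists b => t; rewrite unit_itvE => tI; have /andP[h1 h2] := softness_bounds (thc01 tI).
have b0 := softness_gt0 tI; have bb := lt_trans a_gt0 ab.
have b1 : 0 <= (softness (thc t))^-1 by rewrite invr_ge0 ltW.
by rewrite ger0_norm// -[leRHS]invrK lef_pV2// posrE// invr_gt0.
Qed.

Lemma measurable_stiffness : measurable_fun I (fun t => stiffness a b (theta t)).
Proof. by apply: (measurableT_comp measurable_invr); exact: measurable_softness. Qed.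

Lemma state_lhs (dK dphi g h : R -> R) : itg dK -> itg dphi -> itg g -> bm h ->
  ae_unit_itv (fun t => dK t = g t) -> ae_unit_itv (fun t => dphi t = h t) ->
  int01 (fun t => stiffness a b (theta t) * dK t * dphi t) =
  int01 (fun t => (beta t)^-1 * g t * h t).
Proof.
move=> iK ip ig bh eK ep; apply: ae_eq_int01.
- apply: measurable_funM; [apply: measurable_funM|].
  + exact: measurable_stiffness.
  + exact: itg_measurable.
  + exact: itg_measurable.
- apply: measurable_funM; [apply: measurable_funM|].
  + by case: stiffness_bm.
  + exact: itg_measurable.
  + by case: bh.
- apply: ae_unit_itv_filter (ae_unit_itvI thE (ae_unit_itvI eK ep)) => t _ [-> [-> ->]].
  by rewrite stiffnessE.
Qed.

(** Elements of [X] vanish only at 0, so every bounded measurable function is almost everywhere the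
    derivative of one of them. After [exchange] the weak equation thus forces [K' / beta + M = 0]
    almost everywhere, including the natural boundary condition at 1. *)
Lemma state_equation_beam_angle K : spaceXtilde K -> state_equation a b theta K ->
  beam_angle beta (fun t => - K t).
Proof.
move=> [sX Kitv] seq.
have [iW KW] := spaceX_prim sX.
have [cK _ _] := sX.1.
have bK := bmN (bm_within_continuous cK).
have [k kE] : exists k, k = fun t => - K t by eexists.
rewrite -kE in bK *.
have bB := bm_bending bK.
have bM := tail_bm (bm_itg bB).
have [M ME] : exists M, M = tail (bending k) by eexists.
rewrite -ME in bM.
have [W WE] : exists W, W = weak_deriv K by eexists.
rewrite -WE in iW KW.
(* Testing with a primitive of the sign of [h] shows [h = 0]. *)
pose h t := (beta t)^-1 * W t + M t.
have iBW : itg (fun t => (beta t)^-1 * W t).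
  have := itgM iW stiffness_bm; congr itg; apply/funext => t; exact: mulrC.
have ih : itg h by apply: itgD => //; exact: bm_itg.
pose g t : R := if 0 <= h t then 1 else -1.
have bg : bm g.
  split; last by exists 1 => t _; rewrite /g; case: ifP => _; rewrite ?normrN normr1.
  apply: measurable_fun_if; [exact: measurable_itv| |exact: measurable_cst..].
  by apply: measurable_fun_ler; [exact: measurable_cst|exact: itg_measurable].
have sphi := prim_spaceX bg.
have [ip _] := spaceX_prim sphi.
have ep := weak_deriv_ae sphi (bm_itg bg) (fun t _ => erefl).
have := seq _ sphi; rewrite -WE.
have eW : ae_unit_itv (fun t => W t = W t) by apply: nearW.
rewrite (state_lhs iW ip iW bg eW ep).
have -> : int01 (fun t => (1 - t) * cos (K t) * prim g t) = int01 (fun t => g t * M t).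
  rewrite ME -(exchange (bm_itg bB) (bm_itg bg)).
  by apply: eq_int01 => t _; rewrite /bending kE cosN.
have i1 := itgM iBW bg; have i2 := bm_itg (bmM bg bM).
move=> e0.
have h0 : int01 (fun t => `|h t|) = 0.
  transitivity (int01 (fun t => (beta t)^-1 * W t * g t) + int01 (fun t => g t * M t)).
    rewrite -(int01D i1 i2); apply: eq_int01 => t _.
    have -> : (beta t)^-1 * W t * g t + g t * M t = g t * h t by rewrite /h; ring.
    rewrite /g; have [h0|h0] := leP 0 (h t); first by rewrite mul1r ger0_norm.
    by rewrite mulN1r ltr0_norm.
  by rewrite -e0 subrr.
have {}eW : ae_unit_itv (fun t => W t = - (beta t * M t)).
  apply: ae_unit_itv_filter (ae_eq0_int01_norm ih h0) => t tI ht.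
  have b0 := softness_gt0 tI.
  have -> : W t = beta t * (h t - M t) by rewrite /h; field; rewrite gt_eqF.
  by rewrite ht sub0r mulrN.
have bbM := bmM softness_bm bM.
have kW t : 0 <= t <= 1 -> k t = green beta (bending k) t.
  move=> tI; have -> : k t = - K t by rewrite kE.
  rewrite (KW _ tI) /green -ME.
  have -> : prim W t = prim (fun x => - (beta x * M x)) t.
    apply: ae_eq_int01.
    - by apply: itg_measurable; exact: itg_prim.
    - by apply: itg_measurable; exact: itg_prim (bm_itg (bmN bbM)).
    - by apply: ae_unit_itv_filter eW => x _ ->.
  rewrite /prim -(int01N (itg_prim t (bm_itg (bmN bbM)))).
  by apply: eq_int01 => x _; rewrite mulNr opprK.
split => // t tI; have /andP[] := Kitv t tI.
by rewrite kE oppr_ge0 ltrNl => -> ->.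
Qed.

(** This makes the set from which [phase] chooses nonempty, so that the chosen function really
    solves the state equation. *)
Lemma beam_angle_state_equation k : beam_angle beta k ->
  exists K, spaceXtilde K /\ state_equation a b theta K.
Proof.
move=> [bk ek kitv].
have bB := bm_bending bk.
have bM := tail_bm (bm_itg bB).
have [M ME] : exists M, M = tail (bending k) by eexists.
rewrite -ME in bM.
have bbM := bmM softness_bm bM.
have bG := bmN bbM.
have [K KE] : exists K, K = prim (fun t => - (beta t * M t)) by eexists.
have Kk t : 0 <= t <= 1 -> K t = - k t.
  move=> tI; rewrite ek// /green -ME KE /prim -int01N; last first.
    by apply: itg_prim; exact: bm_itg.
  by apply: eq_int01 => x _; rewrite mulNr.
have sK : spaceX K by rewrite KE; exact: prim_spaceX.
exists K; split.
  split => // t tI; have /andP[t0 t1] := tI; rewrite Kk ?t0 ?(ltW t1)//.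
  by have /andP[h1 h2] := kitv t tI; rewrite ltrN2 h2 oppr_le0.
move=> phi sphi; have [iW KW] := spaceX_prim sK; have [ip pphi] := spaceX_prim sphi.
have eK : ae_unit_itv (fun t => weak_deriv K t = - (beta t * M t)).
  by apply: weak_deriv_ae => //; [exact: bm_itg | rewrite KE].
have -> : int01 (fun t => stiffness a b (theta t) * weak_deriv K t * weak_deriv phi t) =
    int01 (fun t => - (weak_deriv phi t * M t)).
  apply: ae_eq_int01.
  - apply: measurable_funM; [apply: measurable_funM|].
    + exact: measurable_stiffness.
    + exact: itg_measurable.
    + exact: itg_measurable.
  - by apply: measurableT_comp => //; apply: itg_measurable; exact: itgM.
  - apply: ae_unit_itv_filter (ae_unit_itvI thE eK) => t tI [-> ->].
    rewrite stiffnessE; have b0 := softness_gt0 tI.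
    by field; rewrite gt_eqF.
rewrite (int01N (itgM ip bM)) opprK ME -(exchange (bm_itg bB) ip).
apply: eq_int01 => t /andP[t0 t1]; have tI : 0 <= t <= 1 by rewrite !ltW.
by rewrite -pphi// /bending Kk// cosN.
Qed.

Lemma phase_beam_angle : beam_angle beta (fun t => - phase a b theta t).
Proof.
have ai : 0 < a^-1 by rewrite invr_gt0.
have [k hk] := beam_angle_exists softness_bm ai softness_itv.
have exK := beam_angle_state_equation hk.
have [h1 h2] : spaceXtilde (phase a b theta) /\ state_equation a b theta (phase a b theta).
  exact: (@xgetPex _ (fun=> 0) [set K | spaceXtilde K /\ state_equation a b theta K]).
exact: state_equation_beam_angle.
Qed.

Lemma complianceE c : compliance a b c theta =
  int01 (fun t => (1 - t) * sin (- phase a b theta t)) + c * int01 thc.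
Proof.
have [bk _ _] := phase_beam_angle.
rewrite /compliance; congr (_ + c * _).
  rewrite -int01N.
    by apply: eq_int01 => t _; rewrite sinN mulrN.
  have := bm_itg (bmM (@bm_load R) (bm_sin (bmN bk))).
  by congr itg; apply/funext => t; rewrite opprK.
apply: ae_eq_int01 => //; by case: bth.
Qed.

End state_equation.

(** * Optimality conditions *)

Section optimality.
Context {R : realType}.
Notation mu := (@lebesgue_measure R).
Notation I := (@unit_itv R).
Implicit Types (s t x y e : R).

Lemma ae_memLpoo (u : R -> R) C : measurable_fun I u -> 0 <= C ->
  ae_unit_itv (fun t => `|u t| <= C) -> memLp +oo%E u.
Proof.
move=> mu1 C0 uC; rewrite /memLp inE; apply/andP; split; rewrite inE/=.
  exact: measurable_restrict_I.
rewrite /finite_norm unlock; case: ifP => _; last by rewrite ltry.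
apply: (@le_lt_trans _ _ C%:E); last by rewrite ltry.
apply/ess_supP; apply: (@filterS _ _ (ae_filter_ringOfSetsType mu) _ _ _ uC).
move=> t h /=; rewrite lee_fin patchE; case: ifPn => [|_]; last by rewrite normr0.
by rewrite inE => /h.
Qed.

Variables (a b c_l : R) (theta : R -> R).
Hypotheses (a_gt0 : 0 < a) (ab : a < b) (c_gt0 : 0 < c_l).
Hypothesis htheta : design theta.

Let thc t := clamp 0 1 (theta t).
Let kappa := a^-1 - b^-1.
Local Notation soft := (softness a b).
Local Notation beta := (fun t => soft (thc t)).
Local Notation k := (fun t => - phase a b theta t).
Local Notation M := (tail (bending k)).
Local Notation J := (compliance a b c_l).

Let mth : measurable_fun I theta. Proof. by apply: memLpoo_measurable; case: htheta. Qed.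

Lemma clamp_design_itv t : 0 <= thc t <= 1.
Proof. exact: clamp_itv. Qed.

Lemma clamp_design_bm : bm thc.
Proof.
split.
  have m1 := measurable_minr mth (measurable_cst (1 : R)).
  exact: (measurable_maxr (measurable_cst (0 : R)) m1).
exists 1 => t _; have /andP[h1 h2] := clamp_design_itv t.
by rewrite ger0_norm.
Qed.

Lemma clamp_design_ae : ae_unit_itv (fun t => theta t = thc t).
Proof.
by apply: ae_unit_itv_filter htheta.2 => t _ h; rewrite /thc clamp_id.
Qed.

Let kappa_gt0 : 0 < kappa.
Proof. by rewrite subr_gt0 ltf_pV2 ?posrE// (lt_trans a_gt0). Qed.

Let hk : beam_angle beta k.
Proof.
apply: phase_beam_angle => //; [exact: clamp_design_bm| |exact: clamp_design_ae].
by move=> t _; exact: clamp_design_itv.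
Qed.

Let thcI t : 0 < t < 1 -> 0 <= thc t <= 1. Proof. by move=> _; exact: clamp_design_itv. Qed.

Let beta_bm : bm beta.
Proof. exact: (softness_bm a_gt0 ab clamp_design_bm thcI). Qed.

Let beta_itv t : 0 < t < 1 -> 0 <= beta t <= a^-1.
Proof. exact: (softness_itv a_gt0 ab thcI). Qed.

Let ai_gt0 : 0 < a^-1. Proof. by rewrite invr_gt0. Qed.

Section adjoint_state.
Variable r : R -> R.
Hypotheses (hr : bm r)
  (er : forall t, 0 < t < 1 -> r t = adjoint_load k (green beta r) t).
Local Notation q := (tail r).
Local Notation g := (fun t => c_l - kappa * (M t * q t)).

Let Mbm : bm M.
Proof. by apply: tail_bm; apply: bm_itg; apply: bm_bending; case: hk. Qed.
Let qbm : bm q. Proof. by apply: tail_bm; exact: bm_itg. Qed.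

Lemma switching_bm : bm g.
Proof. by apply: bmB; [exact: bm_cst | apply: bmZ; exact: bmM]. Qed.

(** Only one-sided variations are available, as the bounds 0 and 1 may be active; the bound 1 on
    [eta] makes [e] control the norm of the perturbation. *)
Definition admissible (eta : R -> R) :=
  [/\ bm eta, forall t, 0 < t < 1 -> `|eta t| <= 1 &
  forall e t, 0 <= e <= 1 -> 0 < t < 1 -> 0 <= thc t + e * eta t <= 1].

Lemma compliance_expansion eta : admissible eta ->
  exists2 C, 0 <= C & forall e, 0 <= e <= 1 ->
  `|J (fun t => theta t + e * eta t) - J theta - e * int01 (fun t => eta t * g t)|
    <= C * e ^+ 2.
Proof.
move=> [bmeta eta1 etaI].
(* The derivative of [soft] in direction [eta]; [soft] being affine, the perturbed weight equals
   [beta + e * zeta] exactly. *)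
pose zeta t := - kappa * eta t.
have hz : bm zeta by exact: bmZ.
have zZ t : 0 < t < 1 -> `|zeta t| <= kappa.
  move=> tI; rewrite normrM normrN (gtr0_norm kappa_gt0).
  by rewrite ler_piMr ?eta1// ltW.
have [P P0 hP] := bm_bound (green_bm beta_bm hr).
have [Q0 Q00 hQ0] := bm_bound hr.
have hQ t : `|q t| <= Q0 by apply: norm_tail => //; exact: bm_itg.
pose S := kappa * (2 + a^-1).
have S0 : 0 <= S by rewrite mulr_ge0 ?ltW// addr_gt0.
exists (S ^+ 2 + S ^+ 2 * P + kappa * S * Q0).
  have S2 := sqr_ge0 S; apply: addr_ge0; first exact: addr_ge0 S2 (mulr_ge0 S2 (ltW P0)).
  exact: mulr_ge0 (mulr_ge0 (ltW kappa_gt0) S0) (ltW Q00).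
move=> e e01; have [e0 e1] := andP e01.
pose th' t := theta t + e * eta t; pose thc' t := thc t + e * eta t.
have bth' : bm thc' by apply: bmD; [exact: clamp_design_bm | exact: bmZ].
have mth' : measurable_fun I th'.
  by apply: measurable_funD => //; case: (bmZ e bmeta).
have thc'I t : 0 < t < 1 -> 0 <= thc' t <= 1 by exact: etaI.
have thE' : ae_unit_itv (fun t => th' t = thc' t).
  by apply: ae_unit_itv_filter clamp_design_ae => t _; rewrite /th' => ->.
have hk' := phase_beam_angle a_gt0 ab mth' bth' thc'I thE'.
have J' := complianceE a_gt0 ab mth' bth' thc'I thE' c_l.
have J0 := complianceE a_gt0 ab mth clamp_design_bm thcI clamp_design_ae c_l.
have sE : (fun t => soft (thc' t)) = fun t => beta t + e * zeta t.
  by apply/funext => t; rewrite /softness /thc' /zeta /kappa; ring.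
rewrite sE in hk'.
have := load_derivative beta_bm ai_gt0 beta_itv hk hz (ltW kappa_gt0) zZ e0 hk' hr er hP hQ.
move=> hld; rewrite [leRHS]mulrC; apply: le_trans hld.
rewrite le_eqVlt; apply/orP; left; apply/eqP; congr `|_|.
rewrite J' J0.
have i1 := bm_itg bmeta; have i2 := bm_itg (bmM bmeta (bmM Mbm qbm)).
have -> : int01 thc' = int01 thc + e * int01 eta.
  by rewrite -(int01Z _ i1) -(int01D (bm_itg clamp_design_bm) (itgZ e i1)).
have -> : int01 (fun t => zeta t * (M t * q t)) =
    - kappa * int01 (fun t => eta t * (M t * q t)).
  by rewrite -(int01Z _ i2); apply: eq_int01 => t _; rewrite /zeta mulrA.
have -> : int01 (fun t => eta t * g t) =
    c_l * int01 eta - kappa * int01 (fun t => eta t * (M t * q t)).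
  rewrite -(int01Z _ i1) -(int01Z _ i2) -(int01B (itgZ _ i1) (itgZ _ i2)).
  by apply: eq_int01 => t _; ring.
set A0 := int01 (fun t => (1 - t) * sin (- phase a b th' t)).
set A1 := int01 (fun t => _ * sin (- phase a b theta t)).
set A2 := int01 eta; set A3 := int01 (fun t => eta t * _); set A4 := int01 thc.
ring.
Qed.

(* Satisfied by minimizers and by critical points, and all that is used of them. *)
Definition almost_descent_free (eta : R -> R) := forall d, 0 < d ->
  exists2 e0, 0 < e0 & forall e, 0 < e <= e0 -> e <= 1 ->
    - (d * e) <= J (fun t => theta t + e * eta t) - J theta.

Lemma variation_ge0 eta : admissible eta -> almost_descent_free eta ->
  0 <= int01 (fun t => eta t * g t).
Proof.
move=> aeta H; have [C C0 hC] := compliance_expansion aeta.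
set D := int01 _ in hC *; rewrite leNgt; apply/negP => D0.
(* With slack [- D / 4] per unit step and [e] so small that [C * e <= - D / 4], the expansion would
   leave at most [D * e / 2 < 0]. The [C + 1] in the choice of [e] keeps the denominator positive
   when [C = 0]. *)
have D4 : 0 < - D / 4 by lra.
have [e0 e00 he] := H _ D4.
pose e := Num.min (Num.min e0 1) (- D / (4 * (C + 1))).
have C1 : 0 < 4 * (C + 1) by lra.
have ep : 0 < e by rewrite !lt_min e00 ltr01 divr_gt0// oppr_gt0.
have ee0 : e <= e0 by rewrite !ge_min lexx.
have e1 : e <= 1 by rewrite !ge_min lexx orbT.
have eD : e <= - D / (4 * (C + 1)) by rewrite ge_min lexx orbT.
have eC : (C + 1) * e <= - D / 4.
  have -> : - D / 4 = (C + 1) * (- D / (4 * (C + 1))) by field; rewrite gt_eqF//; lra.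
  by rewrite ler_wpM2l//; lra.
have ee : 0 < e <= e0 by apply/andP.
have e01 : 0 <= e <= 1 by rewrite ltW.
have h1 := he e ee e1.
have h2 := le_trans (ler_norm _) (hC e e01).
have h3 : 0 <= e * (C * e + 3 / 4 * D).
  have -> : e * (C * e + 3 / 4 * D) = C * e ^+ 2 + e * D - - (- D / 4 * e) by field.
  by lra.
rewrite pmulr_rge0// in h3; have : C * e + e <= - D / 4 by rewrite mulrDl mul1r in eC.
by lra.
Qed.

Lemma optimal_descent_free eta : optimal_design a b c_l theta ->
  admissible eta -> almost_descent_free eta.
Proof.
move=> [_ opt] [bmeta eta1 etaI] d d0; exists 1 => // e /andP[e0 _] e1.
have e01 : 0 <= e <= 1 by rewrite ltW.
have th01 : ae_unit_itv (fun t => 0 <= theta t + e * eta t <= 1).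
  by apply: ae_unit_itv_filter clamp_design_ae => t tI ->; exact: etaI.
have ddes : design (fun t => theta t + e * eta t).
  split=> //; apply: (@ae_memLpoo _ 1) => //.
    by apply: measurable_funD => //; case: (bmZ e bmeta).
  by apply: ae_unit_itv_filter th01 => t _ /andP[h1 h2]; rewrite ger0_norm.
apply: (@le_trans _ _ 0); first by rewrite oppr_le0 mulr_ge0// ltW.
by rewrite subr_ge0 opt.
Qed.

Lemma critical_descent_free eta : critical_point a b c_l theta ->
  admissible eta -> almost_descent_free eta.
Proof.
move=> [_ [L [linL _ frechet] Lge0]] [bmeta eta1 etaI] d d0.
have m0 := bm_memLpoo (bm_cst (0 : R)).
have meta := bm_memLpoo bmeta.
have [d' d'0 hd'] := frechet d d0.
have L0 : L (fun=> 0) = 0.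
  have := linL 1 _ _ m0 m0; rewrite (_ : (fun _ : R => 1 * 0 + 0) = fun=> 0).
    by rewrite mul1r => /eqP; rewrite -subr_eq0 opprD addrA subrr sub0r oppr_eq0 => /eqP.
  by apply/funext => t; rewrite mulr0 addr0.
(* Admissibility of the full step [e = 1] forces [eta >= 0] where the design is 0 and [eta <= 0]
   where it is 1, the cone in the definition of a critical point. *)
have Leta : 0 <= L eta.
  apply: Lge0 => //; apply: ae_unit_itv_filter clamp_design_ae => t tI -> h.
    by have := etaI 1 t; rewrite h mul1r add0r lexx ler01 => /(_ isT tI) /andP[].
  have := etaI 1 t; rewrite h mul1r lexx ler01 => /(_ isT tI) /andP[_].
  by rewrite gerDl.
exists d' => // e /andP[e0 ed] e1.
have hn : Linfty_norm (fun t => e * eta t) <= e.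
  apply: Linfty_norm_le; first exact: ltW.
  by move=> t tI; rewrite normrM gtr0_norm// ler_piMr ?eta1// ltW.
have he := hd' _ (bm_memLpoo (bmZ e bmeta)) (le_trans hn ed).
have Le : L (fun t => e * eta t) = e * L eta.
  have := linL e _ _ meta m0; rewrite L0 addr0 => <-.
  by congr L; apply/funext => t; rewrite addr0.
rewrite Le in he.
have h1 : d * Linfty_norm (fun t => e * eta t) <= d * e by rewrite ler_wpM2l// ltW.
have h2 : 0 <= e * L eta by rewrite mulr_ge0// ltW.
have := le_trans he h1; rewrite ler_norml => /andP[h3 _].
by lra.
Qed.

Lemma variation_eq0 eta : admissible eta -> almost_descent_free eta ->
  (forall t, 0 < t < 1 -> eta t * g t <= 0) ->
  ae_unit_itv (fun t => eta t * g t = 0).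
Proof.
move=> aeta H neg; have v := variation_ge0 aeta H.
have [bmeta _ _] := aeta.
have ieg := bm_itg (bmM bmeta switching_bm).
apply: ae_eq0_int01_norm => //.
apply/eqP; rewrite eq_le; apply/andP; split; last by apply: int01_ge0.
rewrite -oppr_ge0; apply: (le_trans v).
rewrite -(int01N (itg_norm ieg)); apply: le_int01 => //.
  by have := itgZ (-1) (itg_norm ieg); congr itg; apply/funext => t; rewrite mulN1r.
by move=> t tI; rewrite ler0_norm ?opprK// neg.
Qed.

Hypothesis stationary : forall eta, admissible eta -> almost_descent_free eta.

Lemma soft_where_gt0 : ae_unit_itv (fun t => 0 < g t -> thc t = 0).
Proof.
pose eta t := - thc t * (0 < g t)%R%:R.
have meta : bm eta.
  apply: bmM; first by apply: bmN; exact: clamp_design_bm.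
  split; last by exists 1 => t _; case: (0 < _); rewrite ?normr1 ?normr0.
  have -> : (fun t => (0 < g t)%R%:R) = fun t => if 0 < g t then 1 else 0 :> R.
    by apply/funext => t; case: (0 < _).
  apply: measurable_fun_if; [exact: measurable_itv| |exact: measurable_cst..].
  by apply: measurable_fun_ltr; [exact: measurable_cst | case: switching_bm].
have aeta : admissible eta.
  split=> // [t _|e t /andP[e0 e1] _]; have /andP[h0 h1] := clamp_design_itv t.
    rewrite /eta; case: (0 < _); rewrite ?mulr1 ?mulr0 ?normr0//.
    by rewrite normrN ger0_norm.
  rewrite /eta; case: (0 < _); rewrite ?mulr1 ?mulr0 ?addr0 ?h0//.
  have -> : thc t + e * - thc t = (1 - e) * thc t by ring.
  by rewrite mulr_ge0 ?subr_ge0// mulr_ile1 ?subr_ge0// gerBl.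
have neg t : 0 < t < 1 -> eta t * g t <= 0.
  move=> _; rewrite /eta; have [gt0|_] := boolP (0 < g t); last by rewrite mulr0 mul0r.
  have /andP[h0 _] := clamp_design_itv t.
  by rewrite mulr1 mulr_le0_ge0 ?oppr_le0// ltW.
apply: ae_unit_itv_filter (variation_eq0 aeta (stationary aeta) neg) => t _ + gt0.
rewrite /eta gt0 mulr1 => /eqP; rewrite mulf_eq0 oppr_eq0 (gt_eqF gt0) orbF.
by move=> /eqP.
Qed.

Lemma hard_where_lt0 : ae_unit_itv (fun t => g t < 0 -> thc t = 1).
Proof.
pose eta t := (1 - thc t) * (g t < 0)%R%:R.
have meta : bm eta.
  apply: bmM; first by apply: bmB; [exact: bm_cst | exact: clamp_design_bm].
  split; last by exists 1 => t _; case: (_ < 0); rewrite ?normr1 ?normr0.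
  have -> : (fun t => (g t < 0)%R%:R) = fun t => if g t < 0 then 1 else 0 :> R.
    by apply/funext => t; case: (_ < 0).
  apply: measurable_fun_if; [exact: measurable_itv| |exact: measurable_cst..].
  by apply: measurable_fun_ltr; [case: switching_bm | exact: measurable_cst].
have aeta : admissible eta.
  split=> // [t _|e t /andP[e0 e1] _]; have /andP[h0 h1] := clamp_design_itv t.
    rewrite /eta; case: (_ < 0); rewrite ?mulr1 ?mulr0 ?normr0//.
    by rewrite ger0_norm ?subr_ge0// gerBl.
  rewrite /eta; case: (_ < 0); rewrite ?mulr1 ?mulr0 ?addr0 ?h0//.
  rewrite addr_ge0 ?mulr_ge0 ?subr_ge0//=.
  have : e * (1 - thc t) <= 1 * (1 - thc t) by rewrite ler_wpM2r ?subr_ge0.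
  by lra.
have neg t : 0 < t < 1 -> eta t * g t <= 0.
  move=> _; rewrite /eta; have [gt0|_] := boolP (g t < 0); last by rewrite mulr0 mul0r.
  have /andP[_ h1] := clamp_design_itv t.
  by rewrite mulr1 mulr_ge0_le0 ?subr_ge0// ltW.
apply: ae_unit_itv_filter (variation_eq0 aeta (stationary aeta) neg) => t _ + gt0.
rewrite /eta gt0 mulr1 => /eqP; rewrite mulf_eq0 (lt_eqF gt0) orbF subr_eq0.
by move=> /eqP.
Qed.

(** Stationarity determines the design only where the switching function is nonzero; by the two
    strict inequalities of [switching_point] this leaves out at most the point [s]. *)
Lemma stationary_bang_bang : exists s, 0 <= s < 1 /\
  ae_unit_itv (fun t => (t < s -> theta t = 1) /\ (s < t -> theta t = 0)).
Proof.
have lam0 : 0 < c_l / kappa by rewrite divr_gt0.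
have [s [s01 hlt hgt]] := switching_point beta_bm beta_itv hk hr er lam0.
exists s; split=> //.
apply: ae_unit_itv_filter (ae_unit_itvI clamp_design_ae
  (ae_unit_itvI soft_where_gt0 hard_where_lt0)) => t /andP[t0 t1] [-> [h0 h1]].
split=> ts; [apply: h1 | apply: h0].
  have := hlt t; rewrite t0 ts => /(_ isT).
  by rewrite ltr_pdivrMr// mulrC subr_lt0.
have := hgt t; rewrite t1 ts => /(_ isT).
by rewrite ltr_pdivlMr// mulrC subr_gt0.
Qed.

End adjoint_state.

Lemma optimal_or_critical_bang_bang :
  optimal_design a b c_l theta \/ critical_point a b c_l theta ->
  exists s, 0 <= s < 1 /\
    ae_unit_itv (fun t => (t < s -> theta t = 1) /\ (s < t -> theta t = 0)).
Proof.
move=> oc; have [r hr er] := adjoint_exists beta_bm ai_gt0 beta_itv hk.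
apply: (stationary_bang_bang hr er) => eta aeta.
by case: oc => [opt|crit]; [exact: optimal_descent_free | exact: critical_descent_free].
Qed.

End optimality.

Theorem theorem5p7 (R : realType) (a b c_l : R) (theta : R -> R) :
  0 < a -> a < b -> 0 < c_l ->
  (optimal_design a b c_l theta \/ critical_point a b c_l theta) ->
  classical_design theta /\
  exists tstar : R, 0 <= tstar < 1 /\ switches_at a b theta tstar.
Proof.
move=> a0 ab c0 oc.
have des : design theta by case: oc => -[].
have [s [s01 hs]] := optimal_or_critical_bang_bang a0 ab c0 des oc.
have [s0 s1] := andP s01.
have filt := @filterS _ _ (ae_filter_ringOfSetsType (@lebesgue_measure R)) _ _ _ hs.
split.
  apply: ae_unit_itv_filter (ae_unit_itvI hs (ae_unit_itv_neq s)) => t _ [[h1 h0] ts].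
  by have [/h1|/h0|ts'] := ltgtP t s; [right|left|rewrite ts' eqxx in ts].
exists s; split=> //; split; apply: filt => t h /andP[t0 t1].
  have tI : unit_itv t by rewrite unit_itvE t0 (lt_trans t1).
  have [-> //] := h tI; rewrite /stiffness subrr mul0r add0r mul1r invrK.
  by [].
have tI : unit_itv t by rewrite unit_itvE t1 (le_lt_trans s0).
have [_ -> //] := h tI.
by rewrite /stiffness subr0 mul0r addr0 mul1r invrK.
Qed.
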